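(* Let $x=(x(n))\in l^\infty(\mathbb X)$ and let $z_0\in\Gamma$. If the Z-transform $\tilde x(z)=\sum_{j=0}^\infty x(j)z^{-j}$ ($|z|>1$) has a holomorphic extension to a neighborhood of $z_0$, then $z_0\notin\sigma(x)$.
   Context: $\mathbb X$ is a complex Banach space and $\Gamma=\{z\in\mathbb C:|z|=1\}$. $l^\infty(\mathbb X)$ is the space of bounded sequences $(x(n))_{n\ge0}$ in $\mathbb X$ with the sup-norm and $c_0(\mathbb X)$ is its closed subspace of sequences converging to $0$. The translation $(Sx)(n)=x(n+1)$ on $l^\infty(\mathbb X)$ induces a surjective isometry $\bar S$ on the quotient $l^\infty(\mathbb X)/c_0(\mathbb X)$, so $\sigma(\bar S)\subset\Gamma$; the class of $x$ is denoted $\bar x$, and $R(\lambda,\bar S)=(\lambda-\bar S)^{-1}$ for $|\lambda|\ne1$. The spectrum $\sigma(x)\subset\Gamma$ of $x\in l^\infty(\mathbb X)$ is the set of all non-removable singular points of $\lambda\mapsto R(\lambda,\bar S)\bar x$, $|\lambda|\neq1$; that is, $\xi_0\in\Gamma$ is not in $\sigma(x)$ iff there is a neighborhood $U$ of $\xi_0$ and a holomorphic function on $U$ coinciding with $R(\lambda,\bar S)\bar x$ for all $\lambda\in U$ with $|\lambda|\ne1$. A holomorphic extension of $\tilde x$ to a neighborhood of $z_0$ means a holomorphic $\mathbb X$-valued function on an open disk $U$ centered at $z_0$ that coincides with $\tilde x$ on $U\cap\{|z|>1\}$. *)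

(* Defs.v *)
From Stdlib Require Import Reals Lra Lia ClassicalEpsilon FunctionalExtensionality.
From Stdlib Require Import PropExtensionality ProofIrrelevance.
From Coquelicot Require Import Coquelicot.
Open Scope R_scope.

Local Obligation Tactic := idtac.

Section NormUniform.

Context {K : AbsRing} (V : ModuleSpace K) (N : V -> R)
  (N_triangle : forall x y, N (plus x y) <= N x + N y)
  (N_scal : forall (l : K) x, N (scal l x) <= abs l * N x).

Lemma N_zero : N zero <= 0.
Proof.
  rewrite <- (scal_zero_l (zero : V)).
  apply (Rle_trans _ _ _ (N_scal _ _)).
  assert (H : abs (zero : K) = 0) by apply abs_zero.
  change (abs (zero : K) * N zero <= 0); rewrite H; lra.
Qed.

Lemma N_opp (x : V) : N (opp x) <= N x.
Proof.
  rewrite <- scal_opp_one.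
  apply (Rle_trans _ _ _ (N_scal _ _)).
  assert (H : abs (opp one : K) = 1) by apply abs_opp_one.
  change (abs (opp one : K) * N x <= N x); rewrite H; lra.
Qed.

Definition N_ball (x : V) (e : R) (y : V) : Prop := N (minus y x) < e.

Lemma N_ball_center (x : V) (e : posreal) : N_ball x e x.
Proof.
  unfold N_ball; rewrite minus_eq_zero.
  apply (Rle_lt_trans _ _ _ N_zero), cond_pos.
Qed.

Lemma N_ball_sym (x y : V) (e : R) : N_ball x e y -> N_ball y e x.
Proof.
  unfold N_ball; intros H.
  rewrite <- opp_minus; exact (Rle_lt_trans _ _ _ (N_opp _) H).
Qed.

Lemma N_ball_triangle (x y z : V) (e1 e2 : R) :
  N_ball x e1 y -> N_ball y e2 z -> N_ball x (e1 + e2) z.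
Proof.
  unfold N_ball; intros H1 H2.
  rewrite (minus_trans y).
  apply (Rle_lt_trans _ _ _ (N_triangle _ _)); lra.
Qed.

Definition norm_UniformSpace_mixin : UniformSpace.mixin_of V :=
  UniformSpace.Mixin V zero N_ball N_ball_center N_ball_sym N_ball_triangle.

End NormUniform.

Section Group.

Context {G : AbelianGroup}.

Lemma minus_plus_plus (a b c d : G) :
  minus (plus a b) (plus c d) = plus (minus a c) (minus b d).
Proof.
  unfold minus; rewrite opp_plus, <- !plus_assoc; f_equal.
  rewrite !plus_assoc; f_equal; apply plus_comm.
Qed.

Lemma minus_opp_opp (a b : G) : minus (opp a) (opp b) = opp (minus a b).
Proof. symmetry; exact (opp_plus a (opp b)). Qed.

Lemma minus_minus_l (a b : G) : minus (minus a b) a = opp b.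
Proof.
  unfold minus; rewrite (plus_comm a), <- plus_assoc.
  apply (eq_trans (f_equal (plus (opp b)) (plus_opp_r a))), plus_zero_r.
Qed.

Lemma minus_minus_r (a b : G) : minus a (minus a b) = b.
Proof.
  unfold minus at 1; rewrite opp_minus; unfold minus.
  rewrite (plus_comm b), plus_assoc.
  apply (eq_trans (f_equal (fun u => plus u b) (plus_opp_r a))), plus_zero_l.
Qed.

Lemma minus_swap (a b c d : G) : minus a b = minus c d -> minus a c = minus b d.
Proof.
  intros H; rewrite (minus_trans b a c), (minus_trans c b d), H.
  apply plus_comm.
Qed.

Lemma minus_eq0 (a b : G) : minus a b = zero -> a = b.
Proof.
  intros H; rewrite <- (minus_minus_r a b), H; symmetry; apply minus_zero_r.
Qed.

End Group.

Lemma norm_minus_le {K : AbsRing} {V : NormedModule K} (x y : V) :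
  norm (minus x y) <= norm x + norm y.
Proof.
  apply (Rle_trans _ _ _ (norm_triangle _ _)); rewrite norm_opp; apply Rle_refl.
Qed.

Section Linf.

Context {K : AbsRing} {X : NormedModule K}.

Record linf : Type := Linf {
  linf_val :> nat -> X;
  linf_bounded : exists M : R, forall n, norm (linf_val n) <= M }.

Lemma linf_eq (x y : linf) : (forall n, x n = y n) -> x = y.
Proof.
  destruct x as [x hx], y as [y hy]; simpl; intros H.
  assert (E : x = y) by (apply functional_extensionality; exact H).
  subst y; f_equal; apply proof_irrelevance.
Qed.

Program Definition linf_plus (x y : linf) : linf :=
  Linf (fun n => plus (x n) (y n)) _.
Next Obligation.
  intros x y; destruct (linf_bounded x) as [M HM], (linf_bounded y) as [M' HM'].
  exists (M + M'); intros n.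
  apply (Rle_trans _ _ _ (norm_triangle _ _)).
  now apply Rplus_le_compat.
Qed.

Program Definition linf_opp (x : linf) : linf := Linf (fun n => opp (x n)) _.
Next Obligation.
  intros x; destruct (linf_bounded x) as [M HM].
  exists M; intros n; now rewrite norm_opp.
Qed.

Program Definition linf_zero : linf := Linf (fun _ => zero) _.
Next Obligation.
  exists 0; intros _; rewrite norm_zero; lra.
Qed.

Program Definition linf_scal (a : K) (x : linf) : linf :=
  Linf (fun n => scal a (x n)) _.
Next Obligation.
  intros a x; destruct (linf_bounded x) as [M HM].
  exists (abs a * M); intros n.
  apply (Rle_trans _ _ _ (norm_scal _ _)).
  apply Rmult_le_compat_l; [apply abs_ge_0 | apply HM].
Qed.

Program Definition linf_AbelianMonoid_mixin :=
  AbelianMonoid.Mixin linf linf_plus linf_zero _ _ _.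
Next Obligation. intros; apply linf_eq; intros n; apply plus_comm. Qed.
Next Obligation. intros; apply linf_eq; intros n; apply plus_assoc. Qed.
Next Obligation. intros; apply linf_eq; intros n; apply plus_zero_r. Qed.
Canonical linf_AbelianMonoid :=
  AbelianMonoid.Pack linf linf_AbelianMonoid_mixin linf.

Program Definition linf_AbelianGroup_mixin :=
  AbelianGroup.Mixin linf_AbelianMonoid linf_opp _.
Next Obligation. intros x; apply linf_eq; intros n; exact (plus_opp_r (x n)). Qed.
Canonical linf_AbelianGroup :=
  AbelianGroup.Pack linf
    (AbelianGroup.Class linf linf_AbelianMonoid_mixin linf_AbelianGroup_mixin) linf.

Program Definition linf_ModuleSpace_mixin :=
  ModuleSpace.Mixin K linf_AbelianGroup linf_scal _ _ _ _.
Next Obligation. intros a b x; apply linf_eq; intros n; exact (scal_assoc a b (x n)). Qed.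
Next Obligation. intros x; apply linf_eq; intros n; exact (scal_one (x n)). Qed.
Next Obligation. intros a x y; apply linf_eq; intros n; exact (scal_distr_l a (x n) (y n)). Qed.
Next Obligation. intros a b x; apply linf_eq; intros n; exact (scal_distr_r a b (x n)). Qed.
Canonical linf_ModuleSpace :=
  ModuleSpace.Pack K linf
    (ModuleSpace.Class K linf (AbelianGroup.class linf_AbelianGroup)
       linf_ModuleSpace_mixin) linf.

Definition linf_norm (x : linf) : R := Sup_seq (fun n => norm (x n)).

Lemma linf_norm_is_sup (x : linf) :
  (forall n, norm (x n) <= linf_norm x) /\
  (forall M, (forall n, norm (x n) <= M) -> linf_norm x <= M).
Proof.
  destruct (linf_bounded x) as [B HB].
  assert (L : is_lub_Rbar (fun r => exists n, Finite r = norm (x n))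
                (Sup_seq (fun n => norm (x n)))).
  { pose proof (is_sup_seq_lub _ _ (Sup_seq_correct (fun n => norm (x n)))) as H.
    destruct H as [U L]; split.
    - intros r [n Hn]; apply U; exists n; exact Hn.
    - intros b Hb; apply L; intros r [n Hn]; subst r.
      apply (Hb (norm (x n))); exists n; reflexivity. }
  unfold linf_norm.
  destruct L as [U L].
  assert (HF : is_finite (Sup_seq (fun n => norm (x n)))).
  { destruct (Sup_seq (fun n => norm (x n))) as [s | |].
    - reflexivity.
    - specialize (L (Finite B)); exfalso; apply L.
      intros r [n Hn]; injection Hn; intros ->; apply HB.
    - exfalso; apply (U (norm (x 0%nat))); exists 0%nat; reflexivity. }
  rewrite <- HF in U, L; split.
  - intros n; apply (U (norm (x n))); exists n; reflexivity.
  - intros M HM; apply (L (Finite M)).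
    intros r [n Hn]; injection Hn; intros ->; apply HM.
Qed.

Lemma linf_norm_ge (x : linf) n : norm (x n) <= linf_norm x.
Proof. apply linf_norm_is_sup. Qed.

Lemma linf_norm_le (x : linf) M : (forall n, norm (x n) <= M) -> linf_norm x <= M.
Proof. apply linf_norm_is_sup. Qed.

Lemma linf_norm_triangle (x y : linf) :
  linf_norm (plus x y) <= linf_norm x + linf_norm y.
Proof.
  apply linf_norm_le; intros n.
  apply (Rle_trans _ _ _ (norm_triangle _ _)).
  apply Rplus_le_compat; apply linf_norm_ge.
Qed.

Lemma linf_norm_scal (a : K) (x : linf) :
  linf_norm (scal a x) <= abs a * linf_norm x.
Proof.
  apply linf_norm_le; intros n.
  apply (Rle_trans _ _ _ (norm_scal _ _)).
  apply Rmult_le_compat_l; [apply abs_ge_0 | apply linf_norm_ge].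
Qed.

Lemma linf_norm_eq0 (x : linf) : linf_norm x = 0 -> x = zero.
Proof.
  intros H; apply linf_eq; intros n; apply norm_eq_zero.
  apply Rle_antisym; [| apply norm_ge_0].
  rewrite <- H; apply linf_norm_ge.
Qed.

Definition linf_UniformSpace_mixin :=
  norm_UniformSpace_mixin linf_ModuleSpace linf_norm
    linf_norm_triangle linf_norm_scal.
Canonical linf_UniformSpace :=
  UniformSpace.Pack linf linf_UniformSpace_mixin linf.

Canonical linf_NormedModuleAux :=
  NormedModuleAux.Pack K linf
    (NormedModuleAux.Class K linf (ModuleSpace.class K linf_ModuleSpace)
       linf_UniformSpace_mixin) linf.

Program Definition linf_NormedModule_mixin :=
  NormedModule.Mixin K linf_NormedModuleAux linf_norm 1
    linf_norm_triangle linf_norm_scal _ _ linf_norm_eq0.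
Next Obligation. intros x y e H; exact H. Qed.
Next Obligation. intros x y e H; rewrite Rmult_1_l; exact H. Qed.
Canonical linf_NormedModule :=
  NormedModule.Pack K linf
    (NormedModule.Class K linf (NormedModuleAux.class K linf_NormedModuleAux)
       linf_NormedModule_mixin) linf.

End Linf.

Arguments linf {K} X.

Record closed_submodule {K : AbsRing} (V : NormedModule K) : Type := ClosedSubmodule {
  csm_mem :> V -> Prop;
  csm_zero : csm_mem zero;
  csm_plus : forall x y, csm_mem x -> csm_mem y -> csm_mem (plus x y);
  csm_scal : forall (a : K) x, csm_mem x -> csm_mem (scal a x);
  csm_closed : closed csm_mem }.

Arguments csm_zero {K V}.
Arguments csm_plus {K V}.
Arguments csm_scal {K V}.
Arguments csm_closed {K V}.

Section Quotient.

Context {K : AbsRing} {V : NormedModule K} (W : closed_submodule V).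

Record quot : Type := Quot {
  quot_set : V -> Prop;
  quot_coset : exists v, quot_set = fun w => W (minus w v) }.

Lemma quot_eq (p q : quot) : (forall v, quot_set p v <-> quot_set q v) -> p = q.
Proof.
  destruct p as [P hP], q as [Q hQ]; simpl; intros H.
  assert (E : P = Q).
  { apply functional_extensionality; intros v.
    now apply propositional_extensionality. }
  subst Q; f_equal; apply proof_irrelevance.
Qed.

Definition cls (v : V) : quot :=
  Quot (fun w => W (minus w v)) (ex_intro _ v eq_refl).

Definition rep (p : quot) : V :=
  proj1_sig (constructive_indefinite_description _ (quot_coset p)).

Lemma csm_opp v : W v -> W (opp v).
Proof.
  intros H; replace (opp v) with (scal (opp one : K) v) by exact (scal_opp_one v).
  now apply csm_scal.
Qed.

Lemma csm_minus v w : W v -> W w -> W (minus v w).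
Proof. intros; apply csm_plus; [| apply csm_opp]; assumption. Qed.

Lemma cls_rep (p : quot) : cls (rep p) = p.
Proof.
  apply quot_eq; intros w; unfold rep.
  destruct (constructive_indefinite_description _ _) as [v Hv]; simpl.
  now rewrite Hv.
Qed.

Lemma cls_eq (v w : V) : cls v = cls w <-> W (minus v w).
Proof.
  split.
  - intros H.
    assert (E : quot_set (cls v) v = quot_set (cls w) v) by now rewrite H.
    simpl in E; rewrite <- E, minus_eq_zero; apply csm_zero.
  - intros H.
    apply quot_eq; intros u; simpl; split; intros Hu.
    + rewrite (minus_trans v); now apply csm_plus.
    + rewrite (minus_trans w); apply csm_plus; [assumption |].
      rewrite <- opp_minus; now apply csm_opp.
Qed.

Lemma rep_cls (v : V) : W (minus (rep (cls v)) v).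
Proof. apply cls_eq, cls_rep. Qed.

Definition quot_plus (p q : quot) : quot := cls (plus (rep p) (rep q)).
Definition quot_opp (p : quot) : quot := cls (opp (rep p)).
Definition quot_scal (a : K) (p : quot) : quot := cls (scal a (rep p)).

Lemma quot_plus_cls v w : quot_plus (cls v) (cls w) = cls (plus v w).
Proof.
  apply cls_eq.
  replace (minus (plus (rep (cls v)) (rep (cls w))) (plus v w))
    with (plus (minus (rep (cls v)) v) (minus (rep (cls w)) w))
    by (symmetry; exact (minus_plus_plus (rep (cls v)) (rep (cls w)) v w)).
  apply csm_plus; apply rep_cls.
Qed.

Lemma quot_opp_cls v : quot_opp (cls v) = cls (opp v).
Proof.
  apply cls_eq.
  replace (minus (opp (rep (cls v))) (opp v)) with (opp (minus (rep (cls v)) v))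
    by (symmetry; exact (minus_opp_opp (rep (cls v)) v)).
  apply csm_opp, rep_cls.
Qed.

Lemma quot_scal_cls a v : quot_scal a (cls v) = cls (scal a v).
Proof.
  apply cls_eq.
  refine (eq_ind _ W _ _ (scal_minus_distr_l a (rep (cls v)) v)).
  apply csm_scal, rep_cls.
Qed.

Program Definition quot_AbelianMonoid_mixin :=
  AbelianMonoid.Mixin quot quot_plus (cls zero) _ _ _.
Next Obligation.
  intros p q; rewrite <- (cls_rep p), <- (cls_rep q), !quot_plus_cls.
  f_equal; apply plus_comm.
Qed.
Next Obligation.
  intros p q r; rewrite <- (cls_rep p), <- (cls_rep q), <- (cls_rep r), !quot_plus_cls.
  f_equal; apply plus_assoc.
Qed.
Next Obligation.
  intros p; rewrite <- (cls_rep p), !quot_plus_cls; f_equal; apply plus_zero_r.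
Qed.
Canonical quot_AbelianMonoid :=
  AbelianMonoid.Pack quot quot_AbelianMonoid_mixin quot.

Program Definition quot_AbelianGroup_mixin :=
  AbelianGroup.Mixin quot_AbelianMonoid quot_opp _.
Next Obligation.
  intros p; rewrite <- (cls_rep p), quot_opp_cls.
  exact (eq_trans (quot_plus_cls _ _) (f_equal cls (plus_opp_r (rep p)))).
Qed.
Canonical quot_AbelianGroup :=
  AbelianGroup.Pack quot
    (AbelianGroup.Class quot quot_AbelianMonoid_mixin quot_AbelianGroup_mixin) quot.

Lemma cls_plus v w : cls (plus v w) = plus (cls v) (cls w).
Proof. symmetry; apply quot_plus_cls. Qed.

Lemma cls_opp v : cls (opp v) = opp (cls v).
Proof. symmetry; apply quot_opp_cls. Qed.

Lemma cls_minus v w : cls (minus v w) = minus (cls v) (cls w).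
Proof. unfold minus; now rewrite cls_plus, cls_opp. Qed.

Program Definition quot_ModuleSpace_mixin :=
  ModuleSpace.Mixin K quot_AbelianGroup quot_scal _ _ _ _.
Next Obligation.
  intros a b p; rewrite <- (cls_rep p), !quot_scal_cls.
  exact (f_equal cls (scal_assoc a b (rep p))).
Qed.
Next Obligation.
  intros p; rewrite <- (cls_rep p), !quot_scal_cls.
  exact (f_equal cls (scal_one (rep p))).
Qed.
Next Obligation.
  intros a p q; rewrite <- (cls_rep p), <- (cls_rep q).
  rewrite <- cls_plus, !quot_scal_cls, <- cls_plus.
  exact (f_equal cls (scal_distr_l a (rep p) (rep q))).
Qed.
Next Obligation.
  intros a b p; rewrite <- (cls_rep p), !quot_scal_cls, <- cls_plus.
  exact (f_equal cls (scal_distr_r a b (rep p))).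
Qed.
Canonical quot_ModuleSpace :=
  ModuleSpace.Pack K quot
    (ModuleSpace.Class K quot (AbelianGroup.class quot_AbelianGroup)
       quot_ModuleSpace_mixin) quot.

Lemma cls_scal a v : cls (scal a v) = scal a (cls v).
Proof. symmetry; apply quot_scal_cls. Qed.

Definition quot_norm (p : quot) : R :=
  Glb_Rbar (fun r => exists v, quot_set p v /\ r = norm v).

Lemma quot_set_cls (p : quot) v : quot_set p v <-> cls v = p.
Proof. rewrite <- (cls_rep p), cls_eq; reflexivity. Qed.

Lemma quot_norm_is_glb (p : quot) :
  (forall v, cls v = p -> quot_norm p <= norm v) /\
  (forall m, (forall v, cls v = p -> m <= norm v) -> m <= quot_norm p).
Proof.
  unfold quot_norm.
  destruct (Glb_Rbar_correct (fun r => exists v, quot_set p v /\ r = norm v))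
    as [L G].
  assert (HF : is_finite (Glb_Rbar (fun r => exists v, quot_set p v /\ r = norm v))).
  { destruct (Glb_Rbar _) as [s | |].
    - reflexivity.
    - exfalso; apply (L (norm (rep p))); exists (rep p); split; [| reflexivity].
      apply quot_set_cls, cls_rep.
    - exfalso; apply (G (Finite 0)); intros r [v [_ ->]]; apply norm_ge_0. }
  rewrite <- HF in L, G; split.
  - intros v Hv; apply (L (norm v)); exists v; split; [| reflexivity].
    now apply quot_set_cls.
  - intros m Hm; apply (G (Finite m)); intros r [v [Hv ->]].
    now apply Hm, quot_set_cls.
Qed.

Lemma quot_norm_le (v : V) : quot_norm (cls v) <= norm v.
Proof. now apply quot_norm_is_glb. Qed.

Lemma quot_norm_ge (p : quot) m :
  (forall v, cls v = p -> m <= norm v) -> m <= quot_norm p.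
Proof. apply quot_norm_is_glb. Qed.

Lemma quot_norm_approx (p : quot) (e : posreal) :
  exists v, cls v = p /\ norm v < quot_norm p + e.
Proof.
  apply NNPP; intros H.
  assert (quot_norm p + e <= quot_norm p); [| destruct e; simpl in *; lra].
  apply quot_norm_ge; intros v Hv.
  apply Rnot_lt_le; intros Hlt; apply H; now exists v.
Qed.

Lemma quot_norm_triangle (p q : quot) :
  quot_norm (plus p q) <= quot_norm p + quot_norm q.
Proof.
  apply le_epsilon; intros e He.
  destruct (quot_norm_approx p (pos_div_2 (mkposreal e He))) as [v [<- Hv]].
  destruct (quot_norm_approx q (pos_div_2 (mkposreal e He))) as [w [<- Hw]].
  rewrite <- cls_plus; apply (Rle_trans _ _ _ (quot_norm_le _)).
  apply (Rle_trans _ _ _ (norm_triangle _ _)); simpl in *; lra.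
Qed.

Lemma quot_norm_scal (a : K) (p : quot) :
  quot_norm (scal a p) <= abs a * quot_norm p.
Proof.
  apply le_epsilon; intros e He.
  assert (Ha : 0 < abs a + 1) by (pose proof (abs_ge_0 a); lra).
  assert (He' : 0 < e / (abs a + 1)) by (apply Rdiv_lt_0_compat; lra).
  destruct (quot_norm_approx p (mkposreal _ He')) as [v [Hv Hn]].
  simpl in Hn; rewrite <- Hv at 1.
  rewrite <- cls_scal; apply (Rle_trans _ _ _ (quot_norm_le _)).
  apply (Rle_trans _ _ _ (norm_scal _ _)).
  apply Rle_trans with (abs a * (quot_norm p + e / (abs a + 1))).
  - apply Rmult_le_compat_l; [apply abs_ge_0 | lra].
  - rewrite Rmult_plus_distr_l; apply Rplus_le_compat_l.
    apply Rle_trans with ((abs a + 1) * (e / (abs a + 1))).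
    + apply Rmult_le_compat_r; lra.
    + right; field; lra.
Qed.

Lemma quot_norm_eq0 (p : quot) : quot_norm p = 0 -> p = zero.
Proof.
  intros H; rewrite <- (cls_rep p); apply cls_eq.
  refine (eq_ind_r W _ (minus_zero_r (rep p))).
  apply csm_closed; intros [e He].
  destruct (quot_norm_approx p e) as [v [Hv Hn]].
  rewrite H, Rplus_0_l in Hn.
  apply (He (minus (rep p) v)).
  - apply norm_compat1.
    replace (minus (minus (rep p) v) (rep p)) with (opp v)
      by (symmetry; exact (minus_minus_l (rep p) v)).
    now rewrite norm_opp.
  - apply cls_eq; now rewrite cls_rep.
Qed.

Definition quot_UniformSpace_mixin :=
  norm_UniformSpace_mixin quot_ModuleSpace quot_norm
    quot_norm_triangle quot_norm_scal.
Canonical quot_UniformSpace :=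
  UniformSpace.Pack quot quot_UniformSpace_mixin quot.

Canonical quot_NormedModuleAux :=
  NormedModuleAux.Pack K quot
    (NormedModuleAux.Class K quot (ModuleSpace.class K quot_ModuleSpace)
       quot_UniformSpace_mixin) quot.

Program Definition quot_NormedModule_mixin :=
  NormedModule.Mixin K quot_NormedModuleAux quot_norm 1
    quot_norm_triangle quot_norm_scal _ _ quot_norm_eq0.
Next Obligation. intros p q e H; exact H. Qed.
Next Obligation. intros p q e H; rewrite Rmult_1_l; exact H. Qed.
Canonical quot_NormedModule :=
  NormedModule.Pack K quot
    (NormedModule.Class K quot (NormedModuleAux.class K quot_NormedModuleAux)
       quot_NormedModule_mixin) quot.

End Quotient.

Arguments cls {K V W}.
Arguments rep {K V W}.

Section Shift.

Context {K : AbsRing} {X : NormedModule K}.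

Definition is_null (x : linf X) : Prop := filterlim x eventually (locally (zero : X)).

Lemma norm_minus_zero (u : X) : norm (minus u zero) = norm u.
Proof. exact (f_equal norm (minus_zero_r u)). Qed.

Lemma is_null_norm (x : linf X) :
  is_null x <-> forall e : posreal, eventually (fun n => norm (x n) < e).
Proof.
  unfold is_null; split.
  - intros H e; apply (filterlim_locally_ball_norm x zero) with (eps := e) in H.
    revert H; apply filter_imp; intros n.
    unfold ball_norm.
    intros Hn; rewrite <- norm_minus_zero; exact Hn.
  - intros H; apply filterlim_locally_ball_norm; intros e.
    generalize (H e); apply filter_imp; intros n.
    unfold ball_norm.
    intros Hn; rewrite <- norm_minus_zero in Hn; exact Hn.
Qed.

Lemma is_null_zero : is_null zero.
Proof. exact (filterlim_const (F := eventually) (zero : X)). Qed.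

Lemma is_null_plus x y : is_null x -> is_null y -> is_null (plus x y).
Proof.
  unfold is_null; intros Hx Hy.
  refine (eq_ind _ (fun l : X => filterlim _ _ (locally l)) _ _
            (plus_zero_r (zero : X))).
  exact (filterlim_comp_2 _ _ _ Hx Hy (filterlim_plus _ _)).
Qed.

Lemma is_null_scal a x : is_null x -> is_null (scal a x).
Proof.
  unfold is_null; intros Hx.
  refine (eq_ind _ (fun l : X => filterlim _ _ (locally l)) _ _ (scal_zero_r a)).
  exact (filterlim_comp _ _ _ _ _ _ _ _ Hx (filterlim_scal_r _ _)).
Qed.

Lemma is_null_closed : closed is_null.
Proof.
  intros x Hx; apply is_null_norm; intros e.
  apply NNPP; intros Hn; apply Hx.
  exists (pos_div_2 e); intros y Hy Hy0; apply Hn.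
  generalize (proj1 (is_null_norm y) Hy0 (pos_div_2 e)).
  apply filter_imp; intros n Hyn.
  rewrite <- (minus_minus_r (y n) (x n)).
  assert (H : norm (minus (y n) (x n)) < e / 2)
    by exact (Rle_lt_trans _ _ _ (linf_norm_ge (minus y x) n) Hy).
  apply (Rle_lt_trans _ _ _ (norm_triangle _ _)); rewrite norm_opp.
  simpl in Hyn; lra.
Qed.

Definition c0 : closed_submodule (@linf_NormedModule K X) :=
  ClosedSubmodule K linf_NormedModule is_null
    is_null_zero is_null_plus is_null_scal is_null_closed.

Program Definition shift (x : linf X) : linf X := Linf (fun n => x (S n)) _.
Next Obligation.
  intros x; destruct (linf_bounded x) as [M HM]; exists M; intros n; apply HM.
Qed.

Lemma shift_null x : is_null x -> is_null (shift x).
Proof.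
  rewrite !is_null_norm; intros H e.
  destruct (H e) as [N HN]; exists N; intros n Hn; apply HN; lia.
Qed.

(* The map induced by [shift]; [Sbar_cls] shows that the choice of the
   representative is irrelevant. *)
Definition Sbar (p : quot c0) : quot c0 := cls (shift (rep p)).

Lemma Sbar_cls (x : linf X) : Sbar (cls x) = cls (shift x).
Proof.
  apply cls_eq.
  replace (minus (shift (rep (cls x))) (shift x))
    with (shift (minus (rep (W:=c0) (cls x)) x)) by now apply linf_eq.
  apply shift_null, (rep_cls c0).
Qed.

Lemma Sbar_plus (p q : quot c0) : Sbar (plus p q) = plus (Sbar p) (Sbar q).
Proof.
  rewrite <- (cls_rep c0 p), <- (cls_rep c0 q), <- cls_plus, !Sbar_cls, <- cls_plus.
  f_equal; now apply linf_eq.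
Qed.

Lemma Sbar_scal (a : K) (p : quot c0) : Sbar (scal a p) = scal a (Sbar p).
Proof.
  rewrite <- (cls_rep c0 p), <- cls_scal, !Sbar_cls, <- cls_scal.
  f_equal; now apply linf_eq.
Qed.

Lemma Sbar_minus (p q : quot c0) : Sbar (minus p q) = minus (Sbar p) (Sbar q).
Proof.
  rewrite <- (cls_rep c0 p), <- (cls_rep c0 q), <- cls_minus, !Sbar_cls, <- cls_minus.
  f_equal; now apply linf_eq.
Qed.

Definition unshift_seq (x : nat -> X) (n : nat) : X :=
  match n with O => zero | S k => x k end.

Program Definition unshift (x : linf X) : linf X := Linf (unshift_seq x) _.
Next Obligation.
  intros x; destruct (linf_bounded x) as [M HM]; exists (Rmax 0 M).
  intros [| n]; simpl.
  - rewrite norm_zero; apply Rmax_l.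
  - apply (Rle_trans _ _ _ (HM n)), Rmax_r.
Qed.

Lemma null_shift x : is_null (shift x) -> is_null x.
Proof.
  rewrite !is_null_norm; intros H e.
  destruct (H e) as [N HN]; exists (S N); intros [| n] Hn; [lia |].
  apply (HN n); lia.
Qed.

Lemma Sbar_surj (p : quot c0) : exists q, Sbar q = p.
Proof.
  exists (cls (unshift (rep p))).
  apply (eq_trans (Sbar_cls _)).
  refine (eq_trans (f_equal cls _) (cls_rep c0 p)); now apply linf_eq.
Qed.

Lemma Sbar_isometry (p : quot c0) : norm (Sbar p) = norm p.
Proof.
  apply Rle_antisym; apply (quot_norm_ge c0); intros v Hv.
  - rewrite <- Hv, Sbar_cls.
    apply (Rle_trans _ _ _ (quot_norm_le c0 _)).
    apply linf_norm_le; intros n; apply (linf_norm_ge v).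
  - assert (E : p = cls (unshift v)).
    { apply cls_eq in Hv; rewrite <- (cls_rep c0 p); symmetry; apply cls_eq.
      apply null_shift.
      replace (shift (minus (unshift v) (rep p))) with (minus v (shift (rep p)))
        by now apply linf_eq.
      exact Hv. }
    rewrite E; apply (Rle_trans _ _ _ (quot_norm_le c0 _)).
    apply linf_norm_le; intros [| n]; simpl.
    + rewrite norm_zero; apply norm_ge_0.
    + apply (linf_norm_ge v).
Qed.

End Shift.

Arguments c0 {K} X.

Section Ztransform.

Context {X : CompleteNormedModule C_AbsRing}.
Implicit Types x : linf X.

(* [K := C_AbsRing] is forced: left implicit, it is inferred as [C_Ring], and the
   lemmas on [norm] no longer unify. *)
Definition Ztransform x (z : C) : X :=
  iota (is_series (fun j => scal (K := C_AbsRing) (/ z ^ j)%C (x j))).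

Lemma norm_Ztransform_term x (z : C) M j :
  z <> 0 -> (forall n, norm (x n) <= M) ->
  norm (scal (K := C_AbsRing) (/ z ^ j)%C (x j)) <= M * (/ Cmod z) ^ j.
Proof.
  intros Hz HM.
  apply (Rle_trans _ _ _ (norm_scal _ _)); rewrite Rmult_comm.
  change (norm (x j) * Cmod (/ z ^ j)%C <= M * (/ Cmod z) ^ j).
  rewrite Cmod_inv, Cmod_pow, pow_inv; [| apply Cpow_nz, Hz].
  apply Rmult_le_compat_r; [| apply HM].
  apply Rlt_le, Rinv_0_lt_compat, pow_lt, Cmod_gt_0; exact Hz.
Qed.

Lemma Cmod_gt1_neq0 (z : C) : 1 < Cmod z -> z <> 0.
Proof. intros Hz ->; rewrite Cmod_0 in Hz; lra. Qed.

Lemma inv_Cmod_lt1 (z : C) : 1 < Cmod z -> Rabs (/ Cmod z) < 1.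
Proof.
  intros Hz; rewrite Rabs_pos_eq.
  - rewrite <- Rinv_1; apply Rinv_lt_contravar; lra.
  - apply Rlt_le, Rinv_0_lt_compat; lra.
Qed.

Lemma geom_series (z : C) M : 1 < Cmod z ->
  is_series (fun j => M * (/ Cmod z) ^ j) (M / (1 - / Cmod z)).
Proof.
  intros Hz.
  exact (is_series_scal (K := R_AbsRing) (V := R_NormedModule) M _ _
           (is_series_geom _ (inv_Cmod_lt1 z Hz))).
Qed.

Lemma Ztransform_correct x (z : C) : 1 < Cmod z ->
  is_series (fun j => scal (K := C_AbsRing) (/ z ^ j)%C (x j)) (Ztransform x z).
Proof.
  intros Hz; destruct (linf_bounded x) as [M HM].
  destruct (ex_series_le (fun j => scal (K := C_AbsRing) (/ z ^ j)%C (x j))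
              (fun j => M * (/ Cmod z) ^ j)) as [l Hl].
  - intros j; apply norm_Ztransform_term; [now apply Cmod_gt1_neq0 | exact HM].
  - eexists; exact (geom_series z M Hz).
  - unfold Ztransform; apply iota_correct; exists l; split; [exact Hl |].
    intros l' Hl'; exact (filterlim_locally_unique _ _ _ Hl Hl').
Qed.

Lemma norm_Ztransform_le x (z : C) M : 1 < Cmod z ->
  (forall n, norm (x n) <= M) -> norm (Ztransform x z) <= M / (1 - / Cmod z).
Proof.
  intros Hz HM.
  pose proof (geom_series z M Hz) as Hb.
  pose proof (Ztransform_correct x z Hz) as Ha.
  assert (Hn : is_lim_seq (fun n => norm (sum_n (fun j => scal (K := C_AbsRing) (/ z ^ j)%C (x j)) n))
                 (norm (Ztransform x z))).
  { exact (filterlim_comp _ _ _ _ _ _ _ _ Ha (filterlim_norm _)). }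
  refine (is_lim_seq_le _ _ (Finite _) (Finite _) _ Hn Hb); intros n.
  unfold sum_n.
  apply (Rle_trans _ _ _ (norm_sum_n_m _ _ _)).
  apply sum_n_m_le; intros j.
  apply norm_Ztransform_term; [now apply Cmod_gt1_neq0 | exact HM].
Qed.

Lemma Ztransform_shift x (z : C) : 1 < Cmod z ->
  scal (K := C_AbsRing) z (minus (Ztransform x z) (x 0%nat)) = Ztransform (shift x) z.
Proof.
  intros Hz; pose proof (Cmod_gt1_neq0 z Hz) as Hz0.
  assert (H : is_series (fun j => scal (K := C_AbsRing) (/ z ^ j)%C (shift x j))
                (scal (K := C_AbsRing) z (minus (Ztransform x z) (x 0%nat)))).
  { refine (is_series_ext _ _ _ _
              (is_series_scal (K := C_AbsRing) z _ _
                 (is_series_incr_1 (K := C_AbsRing)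
                    (fun j => scal (K := C_AbsRing) (/ z ^ j)%C (x j)) _ _))).
    - intros n; apply (eq_trans (scal_assoc (K := C_AbsRing) z (/ z ^ S n)%C (x (S n)))).
      apply (f_equal (fun a : C => scal (K := C_AbsRing) a (x (S n)))).
      change (z * / z ^ S n = / z ^ n)%C; rewrite Cpow_S.
      field; split; [apply Cpow_nz |]; exact Hz0.
    - refine (eq_ind _ (is_series _) (Ztransform_correct x z Hz) _ _).
      assert (H1 : (/ z ^ 0)%C = one) by (change (/ 1 = 1)%C; field).
      rewrite H1.
      refine (eq_sym (eq_trans (f_equal (plus _) (scal_one (x 0%nat))) _)).
      unfold minus; rewrite <- plus_assoc.
      refine (eq_trans (f_equal (plus _) (plus_opp_l (x 0%nat))) _).
      apply plus_zero_r. }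
  exact (eq_sym (filterlim_locally_unique _ _ _ (Ztransform_correct _ z Hz) H)).
Qed.

End Ztransform.

(* [R(l,T) y = (l - T)^-1 y]; meaningful only when [l - T] is bijective, which
   [Sbar_bijective] below establishes for [T = Sbar] and [Cmod l <> 1]. *)
Definition resolvent {V : NormedModule C_AbsRing} (l : C) (T : V -> V) (y : V) : V :=
  epsilon (inhabits zero) (fun u => minus (scal (K := C_AbsRing) l u) (T u) = y).

Definition holomorphic_on {V : NormedModule C_AbsRing} (U : C -> Prop) (f : C -> V) :
  Prop := forall z, U z -> ex_derive f z.

Definition disk (a : C) (r : R) (z : C) : Prop := Cmod (z - a) < r.

Definition has_holomorphic_extension {V : NormedModule C_AbsRing} (f : C -> V) (a : C) :
  Prop :=
  exists (r : R) (g : C -> V), 0 < r /\ holomorphic_on (disk a r) g /\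
    forall z, disk a r z -> 1 < Cmod z -> g z = f z.

Section Spectrum.

Context {X : CompleteNormedModule C_AbsRing}.
Implicit Types x : linf X.

Definition spectrum x (xi : C) : Prop :=
  Cmod xi = 1 /\
  ~ exists (U : C -> Prop) (F : C -> quot (c0 X)),
      open U /\ U xi /\ holomorphic_on U F /\
      forall l, U l -> Cmod l <> 1 -> F l = resolvent l Sbar (cls x).

Lemma Sbar_eigen (l : C) (p : quot (c0 X)) : Cmod l <> 1 ->
  scal (K := C_AbsRing) l p = Sbar p -> p = zero.
Proof.
  intros Hl H.
  assert (H1 : norm p <= Cmod l * norm p).
  { rewrite <- Sbar_isometry, <- H at 1; exact (norm_scal (K := C_AbsRing) l p). }
  assert (H2 : Cmod l * norm p <= norm p).
  { destruct (Ceq_dec l 0) as [-> | Hl0].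
    - rewrite Cmod_0, Rmult_0_l; apply norm_ge_0.
    - assert (E : p = scal (K := C_AbsRing) (/ l)%C (Sbar p)).
      { rewrite <- H; refine (eq_sym (eq_trans (scal_assoc _ _ _) _)).
        refine (eq_trans (f_equal (fun a : C => scal (K := C_AbsRing) a p) _)
                  (scal_one p)).
        change (/ l * l = 1)%C; now apply Cinv_l. }
      assert (H3 : norm p <= Cmod (/ l) * norm p).
      { rewrite E at 1; rewrite <- (Sbar_isometry p).
        exact (norm_scal (K := C_AbsRing) (/ l)%C (Sbar p)). }
      rewrite Cmod_inv in H3 by exact Hl0.
      apply Cmod_gt_0 in Hl0.
      apply (Rmult_le_compat_l (Cmod l)) in H3; [| lra].
      rewrite <- Rmult_assoc, Rinv_r, Rmult_1_l in H3; lra. }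
  apply (quot_norm_eq0 (c0 X)); change (norm p = 0).
  apply (Rmult_eq_reg_l (Cmod l - 1)); lra.
Qed.

Lemma iter_shift x k n : Nat.iter k shift x n = x (n + k)%nat.
Proof.
  revert n; induction k as [| k IH]; intros n; simpl.
  - f_equal; lia.
  - rewrite IH; f_equal; lia.
Qed.

Fixpoint down_seq (l : C) (x : nat -> X) (k : nat) : X :=
  match k with
  | O => zero
  | S k => minus (scal (K := C_AbsRing) l (down_seq l x k)) (x k)
  end.

Lemma norm_down_seq (l : C) x M k : Cmod l < 1 ->
  (forall n, norm (x n) <= M) -> norm (down_seq l x k) <= M / (1 - Cmod l).
Proof.
  intros Hl HM.
  assert (HM0 : 0 <= M) by exact (Rle_trans _ _ _ (norm_ge_0 _) (HM 0%nat)).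
  induction k as [| k IH]; simpl.
  - apply Rle_trans with 0; [right; exact norm_zero |].
    apply Rmult_le_pos; [exact HM0 |].
    apply Rlt_le, Rinv_0_lt_compat; lra.
  - refine (Rle_trans _ _ _
              (norm_minus_le (scal (K := C_AbsRing) l (down_seq l x k)) (x k)) _).
    replace (M / (1 - Cmod l)) with (Cmod l * (M / (1 - Cmod l)) + M)
      by (field; lra).
    apply Rplus_le_compat; [| apply HM].
    refine (Rle_trans _ _ _ (norm_scal (K := C_AbsRing) l (down_seq l x k)) _).
    exact (Rmult_le_compat_l _ _ _ (Cmod_ge_0 l) IH).
Qed.

Lemma Sbar_resolvent_surj (l : C) (p : quot (c0 X)) : Cmod l <> 1 ->
  exists u, minus (scal (K := C_AbsRing) l u) (Sbar u) = p.
Proof.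
  intros Hl; rewrite <- (cls_rep (c0 X) p).
  set (x := rep p); clearbody x; clear p.
  destruct (linf_bounded x) as [M HM].
  assert (H : exists u : linf X,
             forall k, minus (scal (K := C_AbsRing) l (u k)) (u (S k)) = x k).
  { destruct (Rtotal_order (Cmod l) 1) as [Hlt | [Heq | Hgt]]; [| easy |].
    - assert (Hy : exists B, forall k, norm (down_seq l x k) <= B).
      { exists (M / (1 - Cmod l)); intros k; now apply norm_down_seq. }
      exists (Linf (down_seq l x) Hy); intros k; exact (minus_minus_r _ (x k)).
    - set (y := fun k => scal (K := C_AbsRing) (/ l)%C (Ztransform (Nat.iter k shift x) l)).
      assert (Hy : exists B, forall k, norm (y k) <= B).
      { exists (Cmod (/ l) * (M / (1 - / Cmod l))); intros k.
        refine (Rle_trans _ _ _ (norm_scal (K := C_AbsRing) (/ l)%C _) _).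
        refine (Rmult_le_compat_l _ _ _ (Cmod_ge_0 (/ l)) _).
        apply norm_Ztransform_le; [exact Hgt |].
        intros n; rewrite iter_shift; apply HM. }
      exists (Linf y Hy); intros k; simpl; unfold y; simpl.
      pose proof (Cmod_gt1_neq0 l Hgt) as Hl0.
      assert (Hc : forall v : X, scal (K := C_AbsRing) (/ l)%C
                                  (scal (K := C_AbsRing) l v) = v).
      { intros v; refine (eq_trans (scal_assoc _ _ _) _).
        refine (eq_trans (f_equal (fun a : C => scal (K := C_AbsRing) a v) _)
                  (scal_one v)).
        change (/ l * l = 1)%C; now apply Cinv_l. }
      assert (Hc' : forall v : X, scal (K := C_AbsRing) l
                                  (scal (K := C_AbsRing) (/ l)%C v) = v).
      { intros v; refine (eq_trans (scal_assoc _ _ _) _).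
        refine (eq_trans (f_equal (fun a : C => scal (K := C_AbsRing) a v) _)
                  (scal_one v)).
        change (l * / l = 1)%C; now apply Cinv_r. }
      rewrite <- Ztransform_shift, Hc, Hc' by exact Hgt.
      rewrite iter_shift; exact (minus_minus_r _ (x k)). }
  destruct H as [u Hu]; exists (cls u).
  rewrite Sbar_cls, <- cls_scal.
  refine (eq_trans (eq_sym (cls_minus (c0 X) _ _)) _).
  f_equal; now apply linf_eq.
Qed.

Lemma Sbar_bijective (l : C) (p : quot (c0 X)) : Cmod l <> 1 ->
  exists! u, minus (scal (K := C_AbsRing) l u) (Sbar u) = p.
Proof.
  intros Hl; destruct (Sbar_resolvent_surj l p Hl) as [u Hu].
  exists u; split; [exact Hu |]; intros v Hv; symmetry.
  apply minus_eq0, (Sbar_eigen l); [exact Hl |].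
  refine (eq_trans (scal_minus_distr_l (K := C_AbsRing) l v u) _).
  refine (eq_trans (minus_swap _ (Sbar v) _ (Sbar u) (eq_trans Hv (eq_sym Hu))) _).
  symmetry; apply Sbar_minus.
Qed.

Lemma Sbar_resolventE (l : C) (p : quot (c0 X)) : Cmod l <> 1 ->
  minus (scal (K := C_AbsRing) l (resolvent l Sbar p)) (Sbar (resolvent l Sbar p)) = p.
Proof.
  intros Hl; unfold resolvent; apply epsilon_spec.
  now apply Sbar_resolvent_surj.
Qed.

End Spectrum.

(* Main.v *)
Require Import Defs.
From Stdlib Require Import Reals Lra Lia Classical ClassicalEpsilon List.
From Coquelicot Require Import Coquelicot.
Open Scope R_scope.

(** Let [g] be the holomorphic extension of the Z-transform of [x] near [z0]. For
    [l] near [z0], let [y_0 = g l / l] and [y_(k+1) = l y_k - x k] ([cand]). If this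
    sequence is bounded, it solves [l y - S y = x], so for [Cmod l <> 1] its class is
    the resolvent applied to the class of [x], by the injectivity of [l - Sbar]. It
    remains to see that near [z0], also on the unit circle, [y] is bounded and depends
    holomorphically on [l] for the sup-norm.

    Each [y_k] is holomorphic. For [Cmod l > 1], [y_k] is [1 / l] times the Z-transform
    at [l] of the [k]-th shift of [x]; for [Cmod l < 1], it differs from
    [l ^ k * (g l / l)] by minus the sum of the [l ^ j * x (k - 1 - j)]. Hence
    [norm (y_k l) * |Cmod l - 1| <= K] with [K] independent of [k] and [l]
    ([cand_blowup]). On the circle of centre [a] and radius [r], the number
    [v * (Cmod (a + v) ^ 2 - 1)] is a quadratic polynomial in [v]
    ([circle_weight]) whose value at [v = 0] is [a * r ^ 2]. Multiplying [y_k] by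
    this polynomial cancels the blow-up on the circle, and the maximum principle at the
    centre bounds [y_k a] uniformly in [k] ([norm_le_of_circle_blowup]). Cauchy
    estimates then bound the remainder of the first-order expansion of [y_k] by a
    constant times [Cmod (b - a) ^ 2], uniformly in [k] ([quadratic_remainder]), which
    is differentiability for the sup-norm.

    The only input from complex analysis is the inequality [norm (f a) <= M] when
    [norm f <= M] on a circle of centre [a] and [f] is holomorphic on the closed disk, except
    perhaps at [a], where it is continuous ([norm_center_le]). Holomorphy means mere
    existence of the derivative, so this rests on Goursat's theorem, proved for
    rectangles by bisection and applied to [f (a + exp (s + i t))] on
    [s0 <= s <= ln r], [0 <= t <= 2 pi]: by periodicity, the mean of [f] over a circle
    of centre [a] does not depend on the radius. *)

(** * Bisection of rectangles *)

(** Bisection principle: a property of the rectangles [[x, x + a] * [y, y + b]] that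
    passes from the four quarters of a rectangle to the rectangle, and that holds for
    the small rectangles around each point, holds for the whole rectangle. *)
Lemma rectangle_bisection (P : R -> R -> R -> R -> Prop) (x0 a0 y0 b0 : R) :
  0 <= a0 -> 0 <= b0 ->
  (forall x a y b, 0 <= a -> 0 <= b ->
     x0 <= x -> x + a <= x0 + a0 -> y0 <= y -> y + b <= y0 + b0 ->
     P x (a / 2) y (b / 2) -> P (x + a / 2) (a / 2) y (b / 2) ->
     P x (a / 2) (y + b / 2) (b / 2) -> P (x + a / 2) (a / 2) (y + b / 2) (b / 2) ->
     P x a y b) ->
  (forall u v, x0 <= u <= x0 + a0 -> y0 <= v <= y0 + b0 ->
     exists d, 0 < d /\ forall x a y b,
       0 <= a < d -> 0 <= b < d -> x <= u <= x + a -> y <= v <= y + b ->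
       x0 <= x -> x + a <= x0 + a0 -> y0 <= y -> y + b <= y0 + b0 ->
       P x a y b) ->
  P x0 a0 y0 b0.
Proof.
  intros Ha Hb Hsplit Hloc; apply NNPP; intros HP.
  set (sz := fun (c : R) n => c / 2 ^ n).
  assert (Hsz0 : forall c n, 0 <= c -> 0 <= sz c n).
  { intros c n Hc; unfold sz; apply Rmult_le_pos; [exact Hc|].
    apply Rlt_le, Rinv_0_lt_compat, pow_lt; lra. }
  assert (Hsz : forall c n, sz c (S n) = sz c n / 2).
  { intros c n; unfold sz; simpl; field; apply pow_nonzero; lra. }
  assert (Hszlim : forall c d, 0 <= c -> 0 < d -> exists N, forall n, (N <= n)%nat -> sz c n < d).
  { intros c d Hc Hd.
    destruct (pow_lt_1_zero (/ 2) ltac:(rewrite Rabs_pos_eq; lra) (d / (c + 1)))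
      as [N HN]; [apply Rdiv_lt_0_compat; lra |].
    exists N; intros n Hn; specialize (HN n Hn).
    rewrite Rabs_pos_eq in HN by (apply pow_le; lra).
    unfold sz, Rdiv; rewrite <- pow_inv.
    apply Rle_lt_trans with ((c + 1) * (/ 2) ^ n).
    - apply Rmult_le_compat_r; [apply pow_le |]; lra.
    - apply (Rmult_lt_compat_l (c + 1)) in HN; [| lra].
      replace ((c + 1) * (d / (c + 1))) with d in HN by (field; lra); exact HN. }
  (* Otherwise each bad rectangle has a bad quarter; follow the lower left corners. *)
  set (bad := fun n (p : R * R) =>
    x0 <= fst p /\ fst p + sz a0 n <= x0 + a0 /\ y0 <= snd p /\
    snd p + sz b0 n <= y0 + b0 /\ ~ P (fst p) (sz a0 n) (snd p) (sz b0 n)).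
  assert (Hstep : forall n p, exists q, bad n p ->
    bad (S n) q /\ fst p <= fst q <= fst p + sz a0 (S n) /\
                   snd p <= snd q <= snd p + sz b0 (S n)).
  { intros n [x y]; apply NNPP; intros Hq.
    assert (Hbad : bad n (x, y)).
    { apply NNPP; intros H; apply Hq; exists (x, y); intros; contradiction. }
    pose proof Hbad as (H1 & H2 & H3 & H4 & H5); simpl in *.
    pose proof (Hsz0 a0 n Ha) as Ha'; pose proof (Hsz0 b0 n Hb) as Hb'.
    assert (Hc : forall q, x <= fst q <= x + sz a0 n / 2 ->
       y <= snd q <= y + sz b0 n / 2 -> P (fst q) (sz a0 n / 2) (snd q) (sz b0 n / 2)).
    { intros q Hqx Hqy; apply NNPP; intros HnP; apply Hq; exists q; intros _.
      unfold bad; rewrite !Hsz; repeat split; try lra; exact HnP. }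
    apply H5, Hsplit; try assumption.
    - apply (Hc (x, y)); simpl; lra.
    - apply (Hc (x + sz a0 n / 2, y)); simpl; lra.
    - apply (Hc (x, y + sz b0 n / 2)); simpl; lra.
    - apply (Hc (x + sz a0 n / 2, y + sz b0 n / 2)); simpl; lra. }
  set (next := fun n p => proj1_sig (constructive_indefinite_description _ (Hstep n p))).
  set (s := fix s n := match n with O => (x0, y0) | S k => next k (s k) end).
  assert (Hs : forall n, bad n (s n) /\ fst (s n) <= fst (s (S n)) <= fst (s n) + sz a0 (S n) /\
                   snd (s n) <= snd (s (S n)) <= snd (s n) + sz b0 (S n)).
  { assert (Hnext : forall n, bad n (s n) -> bad (S n) (s (S n)) /\
       fst (s n) <= fst (s (S n)) <= fst (s n) + sz a0 (S n) /\
       snd (s n) <= snd (s (S n)) <= snd (s n) + sz b0 (S n)).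
    { intros n; simpl; unfold next.
      exact (proj2_sig (constructive_indefinite_description _ (Hstep n (s n)))). }
    assert (Hbad : forall n, bad n (s n)).
    { induction n as [| n IH]; [| now apply Hnext].
      unfold bad, sz; simpl; rewrite !Rdiv_1_r; repeat split; try lra; exact HP. }
    intros n; split; [| apply Hnext]; apply Hbad. }
  (* Both coordinates of the corners converge to a point of all the rectangles. *)
  assert (Hlim : forall (z : nat -> R) c, 0 <= c ->
    (forall n, z n <= z (S n) <= z n + sz c (S n)) ->
    exists l, forall n, z n <= l <= z n + sz c n).
  { intros z c Hc Hz.
    assert (Hup : forall n m : nat, z n <= z (n + m)%nat /\
                    z (n + m)%nat + sz c (n + m)%nat <= z n + sz c n).
    { intros n; induction m as [| m IH]; [rewrite Nat.add_0_r; lra |].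
      rewrite Nat.add_succ_r; specialize (Hz (n + m)%nat).
      rewrite !Hsz in *; lra. }
    destruct (ex_finite_lim_seq_incr z (z O + sz c O)) as [l Hl].
    - intros n; apply Hz.
    - intros n; destruct (Hup O n) as [_ H]; simpl in H.
      pose proof (Hsz0 c n Hc); lra.
    - exists l; intros n; split.
      + refine (is_lim_seq_incr_compare z l Hl _ n); intros k; apply Hz.
      + refine (is_lim_seq_le_loc z (fun _ => z n + sz c n) l (Finite _) _ Hl
                  (is_lim_seq_const _)).
        exists n; intros m Hm; destruct (Hup n (m - n)%nat) as [_ H].
        replace (n + (m - n))%nat with m in H by lia.
        pose proof (Hsz0 c m Hc); lra. }
  destruct (Hlim (fun n => fst (s n)) a0 Ha) as [u Hu]; [intros n; apply Hs |].
  destruct (Hlim (fun n => snd (s n)) b0 Hb) as [v Hv]; [intros n; apply Hs |].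
  destruct (Hloc u v) as (d & Hd & HPd).
  { specialize (Hu O); unfold sz in Hu; simpl in Hu; lra. }
  { specialize (Hv O); unfold sz in Hv; simpl in Hv; lra. }
  destruct (Hszlim a0 d Ha Hd) as [N1 HN1], (Hszlim b0 d Hb Hd) as [N2 HN2].
  set (n := (N1 + N2)%nat).
  destruct (Hs n) as ((H1 & H2 & H3 & H4 & H5) & _).
  apply H5, HPd; auto; split; auto; [apply HN1 | apply HN2]; lia.
Qed.

(** * Restriction of scalars *)

Section Realify.

Variable X : CompleteNormedModule C_AbsRing.

(** The complex Banach space [X] as a real one, with the same group, norm and uniform
    structure, so that the Riemann integral of functions [R -> X] makes sense. *)
Definition realify : Type := X.

Definition realify_scal (a : R) (x : X) : X := scal (K := C_AbsRing) (RtoC a) x.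

Lemma realify_scal_assoc (a b : R) (x : X) :
  realify_scal a (realify_scal b x) = realify_scal (a * b) x.
Proof.
  unfold realify_scal; rewrite RtoC_mult; exact (scal_assoc (RtoC a : C_AbsRing) (RtoC b : C_AbsRing) x).
Qed.

Lemma realify_scal_one (x : X) : realify_scal 1 x = x.
Proof. exact (scal_one x). Qed.

Lemma realify_scal_distr_l (a : R) (x y : X) :
  realify_scal a (plus x y) = plus (realify_scal a x) (realify_scal a y).
Proof. exact (scal_distr_l (RtoC a : C_AbsRing) x y). Qed.

Lemma realify_scal_distr_r (a b : R) (x : X) :
  realify_scal (a + b) x = plus (realify_scal a x) (realify_scal b x).
Proof.
  unfold realify_scal; rewrite RtoC_plus; exact (scal_distr_r (RtoC a : C_AbsRing) (RtoC b : C_AbsRing) x).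
Qed.

Canonical realify_AbelianMonoid :=
  AbelianMonoid.Pack realify (AbelianMonoid.class X) realify.
Canonical realify_AbelianGroup :=
  AbelianGroup.Pack realify (AbelianGroup.class X) realify.

Definition realify_ModuleSpace_mixin :=
  ModuleSpace.Mixin R_Ring realify_AbelianGroup realify_scal realify_scal_assoc
    realify_scal_one realify_scal_distr_l realify_scal_distr_r.
Canonical realify_ModuleSpace :=
  ModuleSpace.Pack R_Ring realify
    (ModuleSpace.Class R_Ring realify (AbelianGroup.class X) realify_ModuleSpace_mixin)
    realify.
Canonical realify_UniformSpace :=
  UniformSpace.Pack realify (UniformSpace.class X) realify.
Canonical realify_NormedModuleAux :=
  NormedModuleAux.Pack R_AbsRing realify
    (NormedModuleAux.Class R_AbsRing realify (ModuleSpace.class R_Ring realify_ModuleSpace)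
       (UniformSpace.class X)) realify.

Lemma realify_norm_scal (a : R) (x : X) :
  norm (realify_scal a x) <= abs a * norm x.
Proof.
  unfold realify_scal.
  apply (Rle_trans _ _ _ (norm_scal (K := C_AbsRing) (RtoC a) x)).
  apply Req_le, (f_equal (fun t => t * norm x)), Cmod_R.
Qed.

Definition realify_NormedModule_mixin :=
  NormedModule.Mixin R_AbsRing realify_NormedModuleAux
    (@norm C_AbsRing X) (@norm_factor C_AbsRing X) (@norm_triangle C_AbsRing X)
    realify_norm_scal (@norm_compat1 C_AbsRing X) (@norm_compat2 C_AbsRing X)
    (@norm_eq_zero C_AbsRing X).
Canonical realify_NormedModule :=
  NormedModule.Pack R_AbsRing realify
    (NormedModule.Class R_AbsRing realify (NormedModuleAux.class R_AbsRing realify_NormedModuleAux)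
       realify_NormedModule_mixin) realify.
Canonical realify_CompleteSpace :=
  CompleteSpace.Pack realify (CompleteSpace.class X) realify.
Canonical realify_CompleteNormedModule :=
  CompleteNormedModule.Pack R_AbsRing realify
    (CompleteNormedModule.Class R_AbsRing realify
       (NormedModule.class R_AbsRing realify_NormedModule) (CompleteSpace.class X)) realify.

End Realify.

(** * Identities between linear combinations *)

(** Multiplication by a complex scalar. *)
Notation "c ** v" := (scal (K := C_AbsRing) c v) (at level 40, v at level 39, format "c  **  v").

Section ModuleIdentities.

Context {V : NormedModule C_AbsRing}.

(** Formal linear combinations of atoms numbered by [nat]. *)
Inductive mexp : Type :=
  | MVar (n : nat) | MZero | MPlus (a b : mexp) | MOpp (a : mexp) | MScal (c : C) (a : mexp).

(** The value of an expression; atoms out of the range of [env] are [zero]. *)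
Fixpoint mexp_val (env : list V) (e : mexp) : V :=
  match e with
  | MVar n => nth n env zero
  | MZero => zero
  | MPlus a b => plus (mexp_val env a) (mexp_val env b)
  | MOpp a => opp (mexp_val env a)
  | MScal c a => c ** mexp_val env a
  end.

(** The coefficient of the atom [k] in an expression. *)
Fixpoint mexp_coef (e : mexp) (k : nat) : C :=
  match e with
  | MVar n => if Nat.eqb n k then RtoC 1 else RtoC 0
  | MZero => RtoC 0
  | MPlus a b => (mexp_coef a k + mexp_coef b k)%C
  | MOpp a => (- mexp_coef a k)%C
  | MScal c a => (c * mexp_coef a k)%C
  end.

(** The sum of [c k] times the [k]-th vector of [env]. *)
Fixpoint lincomb (env : list V) (c : nat -> C) : V :=
  match env with
  | nil => zero
  | v :: env => plus (c O ** v) (lincomb env (fun k => c (S k)))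
  end.

Lemma lincomb_ext env : forall c d, (forall k, (k < length env)%nat -> c k = d k) ->
  lincomb env c = lincomb env d.
Proof.
  induction env as [| v env IH]; intros c d H; simpl; [reflexivity |].
  rewrite (H O) by (simpl; lia); f_equal.
  apply IH; intros k Hk; apply H; simpl; lia.
Qed.

Lemma lincomb_zero env : lincomb env (fun _ => RtoC 0) = zero.
Proof.
  induction env as [| v env IH]; simpl; [reflexivity |].
  rewrite IH; refine (eq_trans (plus_zero_r _) (scal_zero_l v)).
Qed.

Lemma lincomb_plus env : forall c d,
  lincomb env (fun k => (c k + d k)%C) = plus (lincomb env c) (lincomb env d).
Proof.
  induction env as [| v env IH]; intros c d; simpl; [symmetry; apply plus_zero_r |].
  rewrite IH.
  refine (eq_trans (f_equal (fun u => plus u _)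
                      (scal_distr_r (c O : C_AbsRing) (d O : C_AbsRing) v)) _).
  rewrite <- !plus_assoc; f_equal; rewrite !plus_assoc; f_equal; apply plus_comm.
Qed.

Lemma lincomb_scal a env : forall c,
  lincomb env (fun k => (a * c k)%C) = a ** lincomb env c.
Proof.
  induction env as [| v env IH]; intros c; simpl.
  - symmetry; exact (scal_zero_r (a : C_AbsRing)).
  - rewrite IH; symmetry.
    refine (eq_trans (scal_distr_l (a : C_AbsRing) _ _) _).
    exact (f_equal (fun u => plus u _) (scal_assoc (a : C_AbsRing) (c O : C_AbsRing) v)).
Qed.

Lemma lincomb_var env : forall n,
  lincomb env (fun k => if Nat.eqb n k then RtoC 1 else RtoC 0) = nth n env zero.
Proof.
  induction env as [| v env IH]; intros [| n]; simpl; try reflexivity.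
  - rewrite lincomb_zero; exact (eq_trans (plus_zero_r _) (scal_one v)).
  - rewrite IH.
    exact (eq_trans (f_equal (fun u => plus u _) (scal_zero_l v)) (plus_zero_l _)).
Qed.

Lemma lincomb_mexp env e : lincomb env (mexp_coef e) = mexp_val env e.
Proof.
  induction e as [n | | a IHa b IHb | a IHa | c a IHa]; simpl.
  - apply lincomb_var.
  - apply lincomb_zero.
  - now rewrite lincomb_plus, IHa, IHb.
  - rewrite <- IHa.
    refine (eq_trans _ (scal_opp_one (K := C_AbsRing) (lincomb env (mexp_coef a)))).
    refine (eq_trans _ (lincomb_scal _ _ _)); apply lincomb_ext; intros k _.
    change (- mexp_coef a k = - (1) * mexp_coef a k)%C; ring.
  - now rewrite lincomb_scal, IHa.
Qed.

Lemma mexp_eq env e1 e2 :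
  (forall k, (k < length env)%nat -> mexp_coef e1 k = mexp_coef e2 k) ->
  mexp_val env e1 = mexp_val env e2.
Proof. intros H; rewrite <- !lincomb_mexp; now apply lincomb_ext. Qed.

End ModuleIdentities.

(** Fails if [v] is not in [env]. *)
Ltac mexp_index v env :=
  lazymatch env with
  | v :: _ => constr:(O)
  | _ :: ?env' => let n := mexp_index v env' in constr:(S n)
  end.

Ltac mexp_atoms V e env :=
  lazymatch e with
  | plus ?a ?b => let env := mexp_atoms V a env in mexp_atoms V b env
  | minus ?a ?b => let env := mexp_atoms V a env in mexp_atoms V b env
  | opp ?a => mexp_atoms V a env
  | zero => env
  | @scal _ _ ?c ?a => mexp_atoms V a env
  (* The second branch is reached when the first one fails: [v] is a new atom. *)
  | ?v => match env with
          | _ => let n := mexp_index v env in env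
          | _ => constr:(@cons V v env)
          end
  end.

Ltac mexp_reify e env :=
  lazymatch e with
  | plus ?a ?b => let a := mexp_reify a env in let b := mexp_reify b env in
                  constr:(MPlus a b)
  | minus ?a ?b => let a := mexp_reify a env in let b := mexp_reify b env in
                   constr:(MPlus a (MOpp b))
  | opp ?a => let a := mexp_reify a env in constr:(MOpp a)
  | zero => constr:(MZero)
  | @scal _ _ ?c ?a => let a := mexp_reify a env in constr:(MScal c a)
  | ?v => let n := mexp_index v env in constr:(MVar n)
  end.

(** Reduces an equality in a complex normed space to the equality of the
    coefficients of the atoms on both sides. *)
Ltac module_coefs V :=
  lazymatch goal with
  | |- ?a = ?b =>
    let env := mexp_atoms V a (@nil V) in
    let env := mexp_atoms V b env in
    let ea := mexp_reify a env in
    let eb := mexp_reify b env in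
    refine (mexp_eq (V := V) env ea eb _);
    let k := fresh "k" in
    let H := fresh "H" in
    intros k H; cbn [length] in H;
    repeat lazymatch type of H with
      | (_ < O)%nat => exfalso; exact (Nat.nlt_0_r _ H)
      | _ => destruct k as [| k]; [clear H | apply Nat.succ_lt_mono in H]
      end;
    cbn [mexp_coef Nat.eqb]
  end.

(** Proves an equality of linear combinations in [V]. *)
Ltac module V := module_coefs V; ring.

(** * Goursat's theorem for rectangles *)

Section Goursat.

Context {X : CompleteNormedModule C_AbsRing}.

(** The Riemann integral of a function with values in a complex Banach space. *)
Definition rint (f : R -> X) (a b : R) : X :=
  RInt (V := realify_CompleteNormedModule X) f a b.

Lemma rint_minus (f g : R -> X) a b :
  ex_RInt (V := realify_NormedModule X) f a b ->
  ex_RInt (V := realify_NormedModule X) g a b ->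
  rint (fun t => minus (f t) (g t)) a b = minus (rint f a b) (rint g a b).
Proof. exact (RInt_minus (V := realify_CompleteNormedModule X) f g a b). Qed.

Lemma rint_Chasles (f : R -> X) a b c :
  ex_RInt (V := realify_NormedModule X) f a b ->
  ex_RInt (V := realify_NormedModule X) f b c ->
  rint f a c = plus (rint f a b) (rint f b c).
Proof.
  intros H1 H2; symmetry.
  exact (RInt_Chasles (V := realify_CompleteNormedModule X) f a b c H1 H2).
Qed.

Lemma rint_minus_const (f : R -> X) a b (c : X) (M : R) : a <= b ->
  ex_RInt (V := realify_NormedModule X) f a b ->
  (forall t, a <= t <= b -> norm (minus (f t) c) <= M) ->
  norm (minus (rint f a b) (RtoC (b - a) ** c)) <= (b - a) * M.
Proof.
  intros Hab Hf HM.
  apply (norm_RInt_le_const (V := realify_NormedModule X)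
           (fun t => minus (f t) c) a b _ M Hab HM).
  apply (is_RInt_minus (V := realify_NormedModule X)).
  - exact (RInt_correct (V := realify_CompleteNormedModule X) _ _ _ Hf).
  - exact (is_RInt_const (V := realify_NormedModule X) a b c).
Qed.

(** [F] is complex differentiable at [s + i t] with derivative [D], as a function of
    the two real coordinates. *)
Definition cdiff2 (F : R -> R -> X) (s t : R) (D : X) : Prop :=
  forall e, 0 < e -> exists d, 0 < d /\ forall s' t',
    Rabs (s' - s) < d -> Rabs (t' - t) < d ->
    norm (minus (minus (F s' t') (F s t)) ((s' - s, t' - t) ** D))
      <= e * (Rabs (s' - s) + Rabs (t' - t)).

Lemma Cmod_le_abs (a b : R) : Cmod (a, b) <= Rabs a + Rabs b.
Proof.
  replace (a, b) with (RtoC a + Ci * RtoC b)%C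
    by (apply injective_projections; simpl; ring).
  apply (Rle_trans _ _ _ (Cmod_triangle _ _)).
  rewrite Cmod_mult, Cmod_Ci, !Cmod_R; lra.
Qed.

Lemma norm_scalC (c : C) (v : X) : norm (c ** v) <= Cmod c * norm v.
Proof. exact (norm_scal (K := C_AbsRing) c v). Qed.

Lemma cdiff2_lim F s t D : cdiff2 F s t D ->
  forall e, 0 < e -> exists d, 0 < d /\ forall s' t',
    Rabs (s' - s) < d -> Rabs (t' - t) < d -> norm (minus (F s' t') (F s t)) < e.
Proof.
  intros H e He; destruct (H 1 Rlt_0_1) as (d & Hd & HF).
  set (K := 2 * (1 + norm D)).
  assert (HK : 0 < K) by (unfold K; pose proof (norm_ge_0 D); lra).
  exists (Rmin d (e / K)); split.
  { apply Rmin_pos; [exact Hd | now apply Rdiv_lt_0_compat]. }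
  intros s' t' Hs Ht.
  assert (Hs1 := Rlt_le_trans _ _ _ Hs (Rmin_r _ _)).
  assert (Ht1 := Rlt_le_trans _ _ _ Ht (Rmin_r _ _)).
  specialize (HF s' t' (Rlt_le_trans _ _ _ Hs (Rmin_l _ _))
                       (Rlt_le_trans _ _ _ Ht (Rmin_l _ _))).
  replace (minus (F s' t') (F s t)) with
    (plus (minus (minus (F s' t') (F s t)) ((s' - s, t' - t) ** D))
          ((s' - s, t' - t) ** D)) by module X.
  refine (Rle_lt_trans _ _ _ (norm_triangle (V := X) _ _) _).
  pose proof (norm_scalC (s' - s, t' - t) D) as H1.
  pose proof (Rmult_le_compat_r _ _ _ (norm_ge_0 D) (Cmod_le_abs (s' - s) (t' - t))) as H2.
  assert (H3 : (Rabs (s' - s) + Rabs (t' - t)) * (1 + norm D) < 2 * (e / K) * (1 + norm D)).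
  { apply Rmult_lt_compat_r; [pose proof (norm_ge_0 D) |]; lra. }
  replace (2 * (e / K) * (1 + norm D)) with e in H3; [lra |].
  unfold K; field; pose proof (norm_ge_0 D); lra.
Qed.

Lemma continuous_eps (f : R -> X) t :
  (forall e, 0 < e -> exists d, 0 < d /\ forall t', Rabs (t' - t) < d ->
     norm (minus (f t') (f t)) < e) ->
  continuous (U := realify_UniformSpace X) f t.
Proof.
  intros H; apply (filterlim_locally_ball_norm (K := R_AbsRing) (U := realify_NormedModule X)).
  intros [e He]; destruct (H e He) as (d & Hd & HF).
  exists (mkposreal d Hd); exact HF.
Qed.

Lemma cdiff2_continuous1 F s t D : cdiff2 F s t D ->
  continuous (U := realify_UniformSpace X) (fun s => F s t) s.
Proof.
  intros H; apply continuous_eps; intros e He.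
  destruct (cdiff2_lim _ _ _ _ H e He) as (d & Hd & HF); exists d; split; [exact Hd |].
  intros s' Hs; apply HF; [exact Hs |]; rewrite Rminus_eq_0, Rabs_R0; exact Hd.
Qed.

Lemma cdiff2_continuous2 F s t D : cdiff2 F s t D ->
  continuous (U := realify_UniformSpace X) (fun t => F s t) t.
Proof.
  intros H; apply continuous_eps; intros e He.
  destruct (cdiff2_lim _ _ _ _ H e He) as (d & Hd & HF); exists d; split; [exact Hd |].
  intros t' Ht; apply HF; [| exact Ht]; rewrite Rminus_eq_0, Rabs_R0; exact Hd.
Qed.

(** The integral of [F(z) dz / i] along the boundary of
    [[x, x + a] * [y, y + b]]. *)
Definition boundary_int (F : R -> R -> X) (x a y b : R) : X :=
  plus (rint (fun t => minus (F (x + a) t) (F x t)) y (y + b))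
       (Ci ** rint (fun s => minus (F s (y + b)) (F s y)) x (x + a)).

Section Rectangle.

Variables (F : R -> R -> X) (x0 a0 y0 b0 : R).
Hypothesis HF : forall s t, x0 <= s <= x0 + a0 -> y0 <= t <= y0 + b0 ->
  exists D, cdiff2 F s t D.

Lemma ex_int1 t x1 x2 : y0 <= t <= y0 + b0 -> x0 <= x1 -> x1 <= x2 -> x2 <= x0 + a0 ->
  ex_RInt (V := realify_NormedModule X) (fun s => F s t) x1 x2.
Proof.
  intros Ht H1 H2 H3.
  apply (ex_RInt_continuous (V := realify_CompleteNormedModule X)).
  intros s; rewrite Rmin_left, Rmax_right by exact H2; intros Hs.
  destruct (HF s t) as [D HD]; [lra | exact Ht |].
  exact (cdiff2_continuous1 _ _ _ _ HD).
Qed.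

Lemma ex_int2 s y1 y2 : x0 <= s <= x0 + a0 -> y0 <= y1 -> y1 <= y2 -> y2 <= y0 + b0 ->
  ex_RInt (V := realify_NormedModule X) (fun t => F s t) y1 y2.
Proof.
  intros Hs H1 H2 H3.
  apply (ex_RInt_continuous (V := realify_CompleteNormedModule X)).
  intros t; rewrite Rmin_left, Rmax_right by exact H2; intros Ht.
  destruct (HF s t) as [D HD]; [exact Hs | lra |].
  exact (cdiff2_continuous2 _ _ _ _ HD).
Qed.

Lemma boundary_int_split x a y b : 0 <= a -> 0 <= b ->
  x0 <= x -> x + a <= x0 + a0 -> y0 <= y -> y + b <= y0 + b0 ->
  boundary_int F x a y b =
    plus (plus (boundary_int F x (a / 2) y (b / 2))
               (boundary_int F (x + a / 2) (a / 2) y (b / 2)))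
         (plus (boundary_int F x (a / 2) (y + b / 2) (b / 2))
               (boundary_int F (x + a / 2) (a / 2) (y + b / 2) (b / 2))).
Proof.
  intros Ha Hb Hx Hxa Hy Hyb; unfold boundary_int.
  replace (x + a / 2 + a / 2) with (x + a) by lra.
  replace (y + b / 2 + b / 2) with (y + b) by lra.
  set (x' := x + a / 2); set (x'' := x + a); set (y' := y + b / 2); set (y'' := y + b).
  assert (Hord : x <= x' /\ x' <= x'' /\ y <= y' /\ y' <= y'')
    by (unfold x', x'', y', y''; lra).
  assert (Ex : forall t x1 x2, y <= t <= y'' -> x <= x1 -> x1 <= x2 -> x2 <= x'' ->
    ex_RInt (V := realify_NormedModule X) (fun s => F s t) x1 x2).
  { intros t x1 x2 Ht H1 H2 H3; unfold x'', y'' in *; apply ex_int1; lra. }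
  assert (Ey : forall s y1 y2, x <= s <= x'' -> y <= y1 -> y1 <= y2 -> y2 <= y'' ->
    ex_RInt (V := realify_NormedModule X) (fun t => F s t) y1 y2).
  { intros s y1 y2 Hs H1 H2 H3; unfold x'', y'' in *; apply ex_int2; lra. }
  assert (Mx : forall t1 t2 x1 x2, y <= t1 <= y'' -> y <= t2 <= y'' ->
    x <= x1 -> x1 <= x2 -> x2 <= x'' ->
    rint (fun s => minus (F s t2) (F s t1)) x1 x2
    = minus (rint (fun s => F s t2) x1 x2) (rint (fun s => F s t1) x1 x2)).
  { intros; apply rint_minus; apply Ex; assumption. }
  assert (My : forall s1 s2 y1 y2, x <= s1 <= x'' -> x <= s2 <= x'' ->
    y <= y1 -> y1 <= y2 -> y2 <= y'' ->
    rint (fun t => minus (F s2 t) (F s1 t)) y1 y2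
    = minus (rint (fun t => F s2 t) y1 y2) (rint (fun t => F s1 t) y1 y2)).
  { intros; apply rint_minus; apply Ey; assumption. }
  assert (Cx : forall t, y <= t <= y'' -> rint (fun s => F s t) x x''
    = plus (rint (fun s => F s t) x x') (rint (fun s => F s t) x' x'')).
  { intros t Ht; apply rint_Chasles; apply Ex; lra. }
  assert (Cy : forall s, x <= s <= x'' -> rint (fun t => F s t) y y''
    = plus (rint (fun t => F s t) y y') (rint (fun t => F s t) y' y'')).
  { intros s Hs; apply rint_Chasles; apply Ey; lra. }
  rewrite (Mx y y'' x x''), (My x x'' y y''), !Cx, !Cy by lra.
  rewrite (Mx y y' x x'), (Mx y' y'' x x'), (Mx y y' x' x''), (Mx y' y'' x' x''),
    (My x x' y y'), (My x x' y' y''), (My x' x'' y y'), (My x' x'' y' y'') by lra.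
  clear; module X.
Qed.

(** On a small rectangle [F] is affine up to [e] times the size, and for an affine
    function each of the two integrals is explicit and they cancel. *)
Lemma boundary_int_local e u v : 0 < e ->
  x0 <= u <= x0 + a0 -> y0 <= v <= y0 + b0 ->
  exists d, 0 < d /\ forall x a y b,
     0 <= a < d -> 0 <= b < d -> x <= u <= x + a -> y <= v <= y + b ->
     x0 <= x -> x + a <= x0 + a0 -> y0 <= y -> y + b <= y0 + b0 ->
     norm (boundary_int F x a y b) <= 2 * e * (a + b) ^ 2.
Proof.
  intros He Hu Hv; destruct (HF u v Hu Hv) as [D HD].
  destruct (HD e He) as (d & Hd & Hdiff); exists d; split; [exact Hd |].
  intros x a y b Ha Hb Hxu Hyv Hx Hxa Hy Hyb.
  assert (Hp : forall s t, x <= s <= x + a -> y <= t <= y + b ->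
     norm (minus (minus (F s t) (F u v)) ((s - u, t - v) ** D)) <= e * (a + b)).
  { intros s t Hs Ht.
    assert (Rabs (s - u) <= a) by (apply Rabs_le; lra).
    assert (Rabs (t - v) <= b) by (apply Rabs_le; lra).
    apply (Rle_trans _ _ _ (Hdiff s t ltac:(lra) ltac:(lra))).
    apply Rmult_le_compat_l; lra. }
  (* [(u, v)] is replaced by an arbitrary base point, so as to compare opposite sides. *)
  assert (Hpp : forall s t s' t', x <= s <= x + a -> y <= t <= y + b ->
     x <= s' <= x + a -> y <= t' <= y + b ->
     norm (minus (minus (F s' t') (F s t)) ((s' - s, t' - t) ** D)) <= 2 * (e * (a + b))).
  { intros s t s' t' Hs Ht Hs' Ht'.
    replace (minus (minus (F s' t') (F s t)) ((s' - s, t' - t) ** D)) with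
      (minus (minus (minus (F s' t') (F u v)) ((s' - u, t' - v) ** D))
             (minus (minus (F s t) (F u v)) ((s - u, t - v) ** D)))
      by (module_coefs X; try ring; apply injective_projections; simpl; ring).
    refine (Rle_trans _ _ _ (norm_minus_le (V := X) _ _) _).
    pose proof (Hp s t Hs Ht); pose proof (Hp s' t' Hs' Ht'); lra. }
  assert (H1 : norm (minus (rint (fun t => minus (F (x + a) t) (F x t)) y (y + b))
                           (RtoC (y + b - y) ** (RtoC a ** D)))
               <= (y + b - y) * (2 * (e * (a + b)))).
  { apply rint_minus_const; [lra | |].
    - apply (ex_RInt_minus (V := realify_NormedModule X)); apply ex_int2; lra.
    - intros t Ht; pose proof (Hpp x t (x + a) t ltac:(lra) Ht ltac:(lra) Ht) as H.
      replace (x + a - x, t - t) with (RtoC a) in H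
        by (apply injective_projections; simpl; ring).
      exact H. }
  assert (H2 : norm (minus (rint (fun s => minus (F s (y + b)) (F s y)) x (x + a))
                           (RtoC (x + a - x) ** ((Ci * RtoC b)%C ** D)))
               <= (x + a - x) * (2 * (e * (a + b)))).
  { apply rint_minus_const; [lra | |].
    - apply (ex_RInt_minus (V := realify_NormedModule X)); apply ex_int1; lra.
    - intros s Hs; pose proof (Hpp s y s (y + b) Hs ltac:(lra) Hs ltac:(lra)) as H.
      replace (s - s, y + b - y) with (Ci * RtoC b)%C in H
        by (apply injective_projections; simpl; ring).
      exact H. }
  unfold boundary_int.
  set (I1 := rint _ y _) in *; set (I2 := rint _ x _) in *.
  replace (plus I1 (Ci ** I2)) with
    (plus (minus I1 (RtoC (y + b - y) ** (RtoC a ** D)))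
          (Ci ** minus I2 (RtoC (x + a - x) ** ((Ci * RtoC b)%C ** D)))).
  2:{ module_coefs X; try ring; apply injective_projections; simpl; ring. }
  refine (Rle_trans _ _ _ (norm_triangle (V := X) _ _) _).
  pose proof (norm_scalC Ci (minus I2 (RtoC (x + a - x) ** ((Ci * RtoC b)%C ** D)))) as H3.
  rewrite Cmod_Ci, Rmult_1_l in H3.
  replace (y + b - y) with b in * by ring; replace (x + a - x) with a in * by ring.
  replace (2 * e * (a + b) ^ 2) with (b * (2 * (e * (a + b))) + a * (2 * (e * (a + b))))
    by ring.
  lra.
Qed.

Lemma Goursat : 0 <= a0 -> 0 <= b0 -> boundary_int F x0 a0 y0 b0 = zero.
Proof.
  intros Ha Hb; apply (norm_eq_zero (V := X)), Rle_antisym; [| apply norm_ge_0].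
  apply le_epsilon; intros e' He'; rewrite Rplus_0_l.
  set (e := e' / (2 * (a0 + b0 + 1) ^ 2)).
  assert (Hden : 0 < 2 * (a0 + b0 + 1) ^ 2).
  { apply Rmult_lt_0_compat; [| apply pow_lt]; lra. }
  assert (He : 0 < e) by (now apply Rdiv_lt_0_compat).
  apply Rle_trans with (2 * e * (a0 + b0) ^ 2).
  - apply (rectangle_bisection
             (fun x a y b => norm (boundary_int F x a y b) <= 2 * e * (a + b) ^ 2)
             x0 a0 y0 b0 Ha Hb).
    + intros x a y b Ha' Hb' Hx Hxa Hy Hyb P1 P2 P3 P4.
      rewrite boundary_int_split by assumption.
      refine (Rle_trans _ _ _ (norm_triangle (V := X) _ _) _).
      eapply Rle_trans; [apply Rplus_le_compat; exact (norm_triangle (V := X) _ _) |].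
      replace (2 * e * (a + b) ^ 2) with (4 * (2 * e * (a / 2 + b / 2) ^ 2)) by field.
      lra.
    + intros u v Hu Hv; now apply boundary_int_local.
  - replace e' with (2 * e * (a0 + b0 + 1) ^ 2) by (unfold e; field; lra).
    apply Rmult_le_compat_l; [lra |]; apply pow_incr; lra.
Qed.

End Rectangle.

End Goursat.

(** * Complex derivatives and polar coordinates *)

Lemma is_derive_eps {V : NormedModule C_AbsRing} (f : C -> V) (z : C) (l : V) :
  is_derive (K := C_AbsRing) f z l <->
  forall e, 0 < e -> exists d, 0 < d /\ forall w : C, Cmod (w - z) < d ->
    norm (minus (minus (f w) (f z)) ((w - z)%C ** l)) <= e * Cmod (w - z).
Proof.
  split.
  - intros [_ H] e He.
    specialize (H z (fun P HP => HP) (mkposreal e He)).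
    destruct H as [d Hd]; exists d; split; [apply cond_pos |].
    intros w Hw; exact (Hd w Hw).
  - intros H; split; [apply is_linear_scal_l |].
    intros y Hy; apply (is_filter_lim_locally_unique (K := C_AbsRing)
       (V := AbsRing_NormedModule C_AbsRing)) in Hy; subst y.
    intros [e He]; destruct (H e He) as (d & Hd & Hw).
    exists (mkposreal d Hd); exact Hw.
Qed.

Lemma derivable_eps (f : R -> R) l : derivable_pt_lim f 0 l ->
  forall e, 0 < e -> exists d, 0 < d /\ forall h, Rabs h < d ->
    Rabs (f h - f 0 - l * h) <= e * Rabs h.
Proof.
  intros H e He; destruct (H e He) as [d Hd]; exists d; split; [apply cond_pos |].
  intros h Hh; destruct (Req_dec h 0) as [-> | Hh0].
  - rewrite Rminus_eq_0, Rmult_0_r, Rminus_0_r, Rabs_R0; lra.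
  - specialize (Hd h Hh0 Hh); rewrite Rplus_0_l in Hd.
    replace (f h - f 0 - l * h) with (((f h - f 0) / h - l) * h) by (field; exact Hh0).
    rewrite Rabs_mult; apply Rmult_le_compat_r; [apply Rabs_pos | lra].
Qed.

Lemma exp_le_compat s t : s <= t -> exp s <= exp t.
Proof.
  intros [H | ->]; [| apply Rle_refl]; now apply Rlt_le, exp_increasing.
Qed.

(** The complex exponential of [s + i t]. *)
Definition polar (s t : R) : C := (exp s * cos t, exp s * sin t).

Lemma Cmod_polar s t : Cmod (polar s t) = exp s.
Proof.
  unfold Cmod, polar; simpl fst; simpl snd.
  replace ((exp s * cos t) ^ 2 + (exp s * sin t) ^ 2)
    with (Rsqr (exp s) * (Rsqr (sin t) + Rsqr (cos t))) by (unfold Rsqr; ring).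
  rewrite sin2_cos2, Rmult_1_r; apply sqrt_Rsqr, Rlt_le, exp_pos.
Qed.

Lemma polar_plus s t u v : polar (s + u) (t + v) = (polar u v * polar s t)%C.
Proof.
  unfold polar; rewrite exp_plus, cos_plus, sin_plus.
  apply injective_projections; simpl; ring.
Qed.

Lemma polar_approx_0 e : 0 < e -> exists d, 0 < d /\ forall u v,
  Rabs u < d -> Rabs v < d ->
  Cmod (polar u v - 1 - (u, v)) <= e * (Rabs u + Rabs v).
Proof.
  intros He; set (e1 := Rmin 1 (e / 8)).
  assert (He1 : 0 < e1) by (apply Rmin_pos; lra).
  assert (H8 : e1 <= e / 8) by apply Rmin_r.
  assert (H1 : e1 <= 1) by apply Rmin_l.
  destruct (derivable_eps _ _ derivable_pt_lim_exp_0 e1 He1) as (d1 & Hd1 & Hexp).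
  destruct (derivable_eps _ _ derivable_pt_lim_sin_0 e1 He1) as (d2 & Hd2 & Hsin).
  destruct (derivable_eps _ _ (derivable_pt_lim_cos 0) e1 He1) as (d3 & Hd3 & Hcos).
  exists (Rmin (Rmin d1 e1) (Rmin d2 d3)); split.
  { apply Rmin_pos; apply Rmin_pos; assumption. }
  intros u v Hu Hv.
  pose proof (Rmin_l (Rmin d1 e1) (Rmin d2 d3)); pose proof (Rmin_r (Rmin d1 e1) (Rmin d2 d3)).
  pose proof (Rmin_l d1 e1); pose proof (Rmin_r d1 e1).
  pose proof (Rmin_l d2 d3); pose proof (Rmin_r d2 d3).
  specialize (Hexp u ltac:(lra)); specialize (Hsin v ltac:(lra));
    specialize (Hcos v ltac:(lra)).
  rewrite exp_0, Rmult_1_l in Hexp; rewrite sin_0, Rminus_0_r, Rmult_1_l in Hsin.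
  rewrite cos_0, sin_0, Ropp_0, Rmult_0_l, Rminus_0_r in Hcos.
  assert (Hu0 := Rabs_pos u); assert (Hv0 := Rabs_pos v).
  assert (Hexp1 : Rabs (exp u - 1) <= 2 * Rabs u).
  { replace (exp u - 1) with ((exp u - 1 - u) + u) by ring.
    apply (Rle_trans _ _ _ (Rabs_triang _ _)).
    assert (e1 * Rabs u <= 1 * Rabs u) by (apply Rmult_le_compat_r; lra); lra. }
  assert (Hexp3 : Rabs (exp u) <= 3).
  { replace (exp u) with ((exp u - 1) + 1) by ring.
    apply (Rle_trans _ _ _ (Rabs_triang _ _)); rewrite Rabs_R1; lra. }
  replace (polar u v - 1 - (u, v))%C with
    (exp u * (cos v - 1) + (exp u - 1 - u), exp u * (sin v - v) + v * (exp u - 1)).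
  2:{ unfold polar; apply injective_projections; simpl; ring. }
  apply (Rle_trans _ _ _ (Cmod_le_abs _ _)).
  assert (G1 : Rabs (exp u * (cos v - 1) + (exp u - 1 - u)) <= 3 * (e1 * Rabs v) + e1 * Rabs u).
  { apply (Rle_trans _ _ _ (Rabs_triang _ _)); rewrite Rabs_mult.
    apply Rplus_le_compat; [| exact Hexp].
    apply Rmult_le_compat; try apply Rabs_pos; assumption. }
  assert (G2 : Rabs (exp u * (sin v - v) + v * (exp u - 1)) <= 3 * (e1 * Rabs v) + Rabs v * (2 * e1)).
  { apply (Rle_trans _ _ _ (Rabs_triang _ _)); rewrite !Rabs_mult.
    apply Rplus_le_compat; apply Rmult_le_compat; try apply Rabs_pos; lra. }
  assert (e1 * Rabs v <= e / 8 * Rabs v) by (apply Rmult_le_compat_r; lra).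
  assert (e1 * Rabs u <= e / 8 * Rabs u) by (apply Rmult_le_compat_r; lra).
  assert (0 <= e * Rabs u) by (apply Rmult_le_pos; lra).
  lra.
Qed.

Lemma polar_approx s t e : 0 < e -> exists d, 0 < d /\ forall s' t',
  Rabs (s' - s) < d -> Rabs (t' - t) < d ->
  Cmod (polar s' t' - polar s t - (s' - s, t' - t)%R * polar s t)
    <= e * (Rabs (s' - s) + Rabs (t' - t)).
Proof.
  intros He; pose proof (exp_pos s) as Hs.
  destruct (polar_approx_0 (e / exp s)) as (d & Hd & H); [now apply Rdiv_lt_0_compat |].
  exists d; split; [exact Hd |]; intros s' t' Hs' Ht'; specialize (H _ _ Hs' Ht').
  replace (polar s' t') with (polar (s' - s) (t' - t) * polar s t)%C
    by (rewrite <- polar_plus; f_equal; ring).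
  replace (polar (s' - s) (t' - t) * polar s t - polar s t - (s' - s, t' - t)%R * polar s t)%C
    with ((polar (s' - s) (t' - t) - 1 - (s' - s, t' - t)%R) * polar s t)%C by ring.
  rewrite Cmod_mult, Cmod_polar.
  apply (Rmult_le_compat_r (exp s)) in H; [| lra].
  replace (e * (Rabs (s' - s) + Rabs (t' - t))) with
    (e / exp s * (Rabs (s' - s) + Rabs (t' - t)) * exp s) by (field; lra).
  exact H.
Qed.

(** * The maximum principle at the centre of a disk *)

Section Center.

Context {X : CompleteNormedModule C_AbsRing}.

Lemma cdiff2_polar (f : C -> X) (a : C) (l : X) s t :
  is_derive (K := C_AbsRing) f (a + polar s t)%C l ->
  cdiff2 (fun s t => f (a + polar s t)%C) s t (polar s t ** l).
Proof.
  intros Hf e He; pose proof (proj1 (is_derive_eps _ _ _) Hf) as Hf'.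
  set (p := polar s t) in *.
  pose proof (Cmod_ge_0 p) as Hp; pose proof (norm_ge_0 l) as Hl.
  set (e1 := Rmin 1 (e / (2 * (1 + norm l)))).
  assert (He1 : 0 < e1) by (apply Rmin_pos; [lra |]; apply Rdiv_lt_0_compat; lra).
  assert (He1l : e1 * norm l <= e / 2).
  { apply Rle_trans with (e / (2 * (1 + norm l)) * (1 + norm l)).
    - apply Rmult_le_compat; try lra; apply Rmin_r.
    - right; field; lra. }
  destruct (Hf' (e / (2 * (Cmod p + 1)))) as (d1 & Hd1 & H1);
    [apply Rdiv_lt_0_compat; lra |].
  destruct (polar_approx s t e1 He1) as (d2 & Hd2 & H2); fold p in H2.
  exists (Rmin d2 (d1 / (2 * (Cmod p + 1)))); split.
  { apply Rmin_pos; [exact Hd2 |]; apply Rdiv_lt_0_compat; lra. }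
  intros s' t' Hs Ht.
  specialize (H2 s' t' (Rlt_le_trans _ _ _ Hs (Rmin_l _ _))
                       (Rlt_le_trans _ _ _ Ht (Rmin_l _ _))).
  apply Rlt_le_trans with (2 := Rmin_r _ _) in Hs.
  apply Rlt_le_trans with (2 := Rmin_r _ _) in Ht.
  set (D := Rabs (s' - s) + Rabs (t' - t)) in *.
  assert (HD : 0 <= D) by (unfold D; pose proof (Rabs_pos (s' - s)); pose proof (Rabs_pos (t' - t)); lra).
  set (p' := polar s' t') in *.
  assert (Hpp : Cmod (p' - p) <= (Cmod p + 1) * D).
  { replace (p' - p)%C with ((p' - p - (s' - s, t' - t)%R * p) + (s' - s, t' - t)%R * p)%C by ring.
    apply (Rle_trans _ _ _ (Cmod_triangle _ _)); rewrite Cmod_mult.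
    pose proof (Rmult_le_compat_r _ _ _ Hp (Cmod_le_abs (s' - s) (t' - t))) as H3.
    fold D in H3.
    assert (e1 * D <= 1 * D) by (apply Rmult_le_compat_r; [exact HD | apply Rmin_l]).
    lra. }
  specialize (H1 (a + p')%C).
  replace (a + p' - (a + p))%C with (p' - p)%C in H1 by ring.
  assert (Hlt : Cmod (p' - p) < d1).
  { apply (Rle_lt_trans _ _ _ Hpp).
    apply Rlt_le_trans with ((Cmod p + 1) * (2 * (d1 / (2 * (Cmod p + 1))))).
    - apply Rmult_lt_compat_l; unfold D; lra.
    - right; field; lra. }
  specialize (H1 Hlt).
  replace (minus (minus (f (a + p')%C) (f (a + p)%C)) ((s' - s, t' - t)%R ** (p ** l))) with
    (plus (minus (minus (f (a + p')%C) (f (a + p)%C)) ((p' - p)%C ** l))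
          ((p' - p - (s' - s, t' - t)%R * p)%C ** l)) by module X.
  refine (Rle_trans _ _ _ (norm_triangle (V := X) _ _) _).
  pose proof (norm_scalC (p' - p - (s' - s, t' - t)%R * p)%C l) as H3.
  assert (H4 : e / (2 * (Cmod p + 1)) * Cmod (p' - p) <= e / 2 * D).
  { replace (e / 2 * D) with (e / (2 * (Cmod p + 1)) * ((Cmod p + 1) * D)) by (field; lra).
    apply Rmult_le_compat_l; [apply Rlt_le, Rdiv_lt_0_compat; lra | exact Hpp]. }
  assert (H5 : Cmod (p' - p - (s' - s, t' - t)%R * p) * norm l <= e1 * D * norm l)
    by (apply Rmult_le_compat_r; assumption).
  assert (H6 : e1 * norm l * D <= e / 2 * D) by (apply Rmult_le_compat_r; assumption).
  replace (e * D) with (e / 2 * D + e / 2 * D) by field.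
  apply Rplus_le_compat; [exact (Rle_trans _ _ _ H1 H4) |].
  apply (Rle_trans _ _ _ H3); lra.
Qed.

(** The function need not be differentiable at the centre, which lets the lemma apply to
    difference quotients. *)
Lemma norm_center_le (f : C -> X) (a : C) (r M : R) : 0 < r ->
  (forall w : C, 0 < Cmod (w - a) <= r -> ex_derive (K := C_AbsRing) f w) ->
  (forall e, 0 < e -> exists d, 0 < d /\ forall w : C, Cmod (w - a) < d ->
     norm (minus (f w) (f a)) < e) ->
  (forall w : C, Cmod (w - a) = r -> norm (f w) <= M) ->
  norm (f a) <= M.
Proof.
  intros Hr Hdiff Hcont HM; apply le_epsilon; intros e He.
  destruct (Hcont e He) as (d & Hd & Hc).
  pose proof PI_RGT_0 as Hpi.
  (* The radius [exp s0] is so small that [f] is within [e] of [f a] on that circle. *)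
  set (s1 := ln r); set (s0 := Rmin s1 (ln (d / 2))).
  assert (Hs : s0 <= s1) by apply Rmin_l.
  set (F := fun s t => f (a + polar s t)%C).
  assert (Hmod : forall s t, Cmod (a + polar s t - a) = exp s).
  { intros s t; rewrite <- (Cmod_polar s t); f_equal; ring. }
  assert (HF : forall s t, s0 <= s <= s0 + (s1 - s0) -> 0 <= t <= 0 + 2 * PI ->
    exists D, cdiff2 F s t D).
  { intros s t Hst _; destruct (Hdiff (a + polar s t)%C) as [l Hl].
    - rewrite Hmod; split; [apply exp_pos |].
      rewrite <- (exp_ln r Hr); apply exp_le_compat; fold s1; lra.
    - exists (polar s t ** l); now apply cdiff2_polar. }
  pose proof (Goursat F s0 (s1 - s0) 0 (2 * PI) HF ltac:(lra) ltac:(lra)) as HG.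
  unfold boundary_int in HG.
  replace (s0 + (s1 - s0)) with s1 in * by ring; rewrite Rplus_0_l in HG, HF.
  assert (Hper : rint (fun s => minus (F s (2 * PI)) (F s 0)) s0 s1 = zero).
  { unfold rint; rewrite (RInt_ext (V := realify_CompleteNormedModule X) _ (fun _ => zero)).
    - rewrite RInt_const; apply (scal_zero_r (V := realify_ModuleSpace X)).
    - intros s _; unfold F.
      replace (polar s (2 * PI)) with (polar s 0).
      + apply (minus_eq_zero (G := X)).
      + unfold polar; now rewrite cos_2PI, sin_2PI, cos_0, sin_0. }
  rewrite Hper in HG.
  assert (HG' : rint (fun t => minus (F s1 t) (F s0 t)) 0 (2 * PI) = zero).
  { rewrite <- HG; module X. }
  assert (Hex : forall s, s0 <= s <= s1 ->
    ex_RInt (V := realify_NormedModule X) (fun t => F s t) 0 (2 * PI)).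
  { intros s Hs'; apply (ex_RInt_continuous (V := realify_CompleteNormedModule X)).
    intros t; rewrite Rmin_left, Rmax_right by lra; intros Ht.
    destruct (HF s t Hs' Ht) as [D HD]; exact (cdiff2_continuous2 _ _ _ _ HD). }
  assert (H : norm (minus (rint (fun t => minus (F s1 t) (F s0 t)) 0 (2 * PI))
                      (RtoC (2 * PI - 0) ** opp (f a))) <= (2 * PI - 0) * (M + e)).
  { apply rint_minus_const; [lra | |].
    - apply (ex_RInt_minus (V := realify_NormedModule X)); apply Hex; lra.
    - intros t _.
      replace (minus (minus (F s1 t) (F s0 t)) (opp (f a)))
        with (minus (F s1 t) (minus (F s0 t) (f a))) by module X.
      refine (Rle_trans _ _ _ (norm_minus_le (V := X) _ _) _).
      apply Rplus_le_compat.
      + apply HM; rewrite Hmod; now apply exp_ln.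
      + apply Rlt_le, Hc; rewrite Hmod.
        apply Rle_lt_trans with (exp (ln (d / 2))); [apply exp_le_compat, Rmin_r |].
        rewrite exp_ln; lra. }
  rewrite HG', Rminus_0_r in H.
  assert (E : f a = RtoC (/ (2 * PI)) ** minus zero (RtoC (2 * PI) ** opp (f a))).
  { module_coefs X; rewrite RtoC_inv by lra; field.
    intros H0; apply RtoC_inj in H0; lra. }
  rewrite E.
  refine (Rle_trans _ _ _ (norm_scalC _ _) _).
  rewrite Cmod_R, Rabs_pos_eq by (apply Rlt_le, Rinv_0_lt_compat; lra).
  replace (M + e) with (/ (2 * PI) * (2 * PI * (M + e))) by (field; lra).
  apply Rmult_le_compat_l; [apply Rlt_le, Rinv_0_lt_compat; lra | exact H].
Qed.

End Center.

Lemma ex_derive_cont {V : NormedModule C_AbsRing} (f : C -> V) (z : C) :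
  ex_derive (K := C_AbsRing) f z ->
  forall e, 0 < e -> exists d, 0 < d /\ forall w : C, Cmod (w - z) < d ->
    norm (minus (f w) (f z)) < e.
Proof.
  intros [l Hl] e He.
  destruct (proj1 (is_derive_eps f z l) Hl 1 Rlt_0_1) as (d & Hd & H).
  pose proof (norm_ge_0 l) as Hn.
  exists (Rmin d (e / (1 + norm l))); split.
  { apply Rmin_pos; [exact Hd | apply Rdiv_lt_0_compat; lra]. }
  intros w Hw.
  specialize (H w (Rlt_le_trans _ _ _ Hw (Rmin_l _ _))).
  apply Rlt_le_trans with (2 := Rmin_r _ _) in Hw.
  replace (minus (f w) (f z)) with
    (plus (minus (minus (f w) (f z)) ((w - z)%C ** l)) ((w - z)%C ** l)) by module V.
  refine (Rle_lt_trans _ _ _ (norm_triangle (V := V) _ _) _).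
  pose proof (norm_scal (K := C_AbsRing) (w - z)%C l) as H1.
  change (abs (w - z)%C) with (Cmod (w - z)) in H1.
  apply (Rle_lt_trans _ _ _ (Rplus_le_compat _ _ _ _ H H1)).
  apply (Rmult_lt_compat_r (1 + norm l)) in Hw; [| lra].
  replace (e / (1 + norm l) * (1 + norm l)) with e in Hw by (field; lra); lra.
Qed.

Lemma is_derive_scal_fun {V : NormedModule C_AbsRing} (c : C -> C) (f : C -> V)
    (z c' : C) (l : V) :
  is_derive (K := C_AbsRing) (V := AbsRing_NormedModule C_AbsRing) c z c' ->
  is_derive (K := C_AbsRing) f z l ->
  is_derive (K := C_AbsRing) (fun w => c w ** f w) z (plus (c' ** f z) (c z ** l)).
Proof.
  intros Hc Hf.
  refine (filterdiff_ext_lin _ _ _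
    (filterdiff_scal_fct (K := C_AbsRing) (U := AbsRing_NormedModule C_AbsRing)
       z c f _ _ _ Hc Hf) _).
  - intros n m; apply Cmult_comm.
  - intros y.
    change (plus ((y * c')%C ** f z) (c z ** (y ** l)) = y ** (plus (c' ** f z) (c z ** l))).
    module V.
Qed.

Lemma is_derive_Cinv (z : C) : z <> 0 ->
  is_derive (K := C_AbsRing) (V := AbsRing_NormedModule C_AbsRing)
    (fun w : C => (/ w)%C) z (- / (z * z))%C.
Proof.
  intros Hz; pose proof (proj1 (Cmod_gt_0 z) Hz) as Hz'.
  apply is_derive_eps; intros e He.
  assert (H3 : 0 < Cmod z ^ 3) by (apply pow_lt; exact Hz').
  exists (Rmin (Cmod z / 2) (e * Cmod z ^ 3 / 2)); split.
  { apply Rmin_pos; [lra |]; apply Rdiv_lt_0_compat; [apply Rmult_lt_0_compat |]; lra. }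
  intros w Hw.
  pose proof (Rlt_le_trans _ _ _ Hw (Rmin_l _ _)) as Hw1.
  pose proof (Rlt_le_trans _ _ _ Hw (Rmin_r _ _)) as Hw2; clear Hw.
  assert (Hw : Cmod z / 2 <= Cmod w).
  { pose proof (Cmod_triangle w (z - w)) as H.
    replace (w + (z - w))%C with z in H by ring.
    replace (z - w)%C with (- (w - z))%C in H by ring; rewrite Cmod_opp in H; lra. }
  assert (Hw0 : w <> 0) by (apply Cmod_gt_0; lra).
  change (Cmod (/ w - / z - (w - z) * - / (z * z)) <= e * Cmod (w - z)).
  replace (/ w - / z - (w - z) * - / (z * z))%C
    with ((w - z) * ((w - z) * / (w * (z * z))))%C by (field; auto).
  rewrite !Cmod_mult, Cmod_inv, !Cmod_mult by (repeat apply Cmult_neq_0; assumption).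
  rewrite Rmult_comm; apply Rmult_le_compat_r; [apply Cmod_ge_0 |].
  apply Rle_trans with (e * Cmod z ^ 3 / 2 * / (Cmod z / 2 * (Cmod z * Cmod z))).
  - apply Rmult_le_compat; [apply Cmod_ge_0 | | lra |].
    + apply Rlt_le, Rinv_0_lt_compat; repeat apply Rmult_lt_0_compat; lra.
    + apply Rinv_le_contravar; [repeat apply Rmult_lt_0_compat; lra |].
      apply Rmult_le_compat_r; [| exact Hw]; apply Rmult_le_pos; lra.
  - right; field; lra.
Qed.

Lemma is_derive_Cid_minus (a z : C) :
  is_derive (K := C_AbsRing) (V := AbsRing_NormedModule C_AbsRing)
    (fun w : C => (w - a)%C) z (RtoC 1).
Proof.
  apply is_derive_eps; intros e He; exists 1; split; [lra |]; intros w _.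
  change (Cmod (w - a - (z - a) - (w - z) * RtoC 1) <= e * Cmod (w - z)).
  replace (w - a - (z - a) - (w - z) * RtoC 1)%C with (RtoC 0) by ring.
  rewrite Cmod_0; apply Rmult_le_pos; [lra | apply Cmod_ge_0].
Qed.

(** * Cauchy estimates *)

Section CauchyEstimates.

Context {X : CompleteNormedModule C_AbsRing}.

(** The maximum principle for the difference quotient at [a], whose value at [a] is the
    derivative. *)
Lemma norm_derive_le (f : C -> X) (a : C) (l : X) (r M : R) : 0 < r ->
  (forall w : C, Cmod (w - a) <= r -> ex_derive (K := C_AbsRing) f w) ->
  (forall w : C, Cmod (w - a) = r -> norm (minus (f w) (f a)) <= M) ->
  is_derive (K := C_AbsRing) f a l -> norm l <= M / r.
Proof.
  intros Hr Hf HM Hl.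
  set (q := fun w : C => if Ceq_dec w a then l else (/ (w - a))%C ** minus (f w) (f a)).
  assert (Hqa : q a = l).
  { unfold q; destruct (Ceq_dec a a) as [_ | H]; [reflexivity | now destruct H]. }
  assert (Hq : forall w : C, w <> a -> q w = (/ (w - a))%C ** minus (f w) (f a)).
  { intros w Hw; unfold q; destruct (Ceq_dec w a); [contradiction | reflexivity]. }
  rewrite <- Hqa; apply (norm_center_le q a r (M / r) Hr).
  - intros w [Hw0 Hwr].
    assert (Hwa : (w - a)%C <> 0) by (apply Cmod_gt_0; exact Hw0).
    apply (ex_derive_ext_loc (K := C_AbsRing)
             (fun w : C => (/ (w - a))%C ** minus (f w) (f a))).
    + exists (mkposreal _ Hw0); intros v Hv; symmetry; apply Hq; intros ->.
      change (Cmod (a - w) < Cmod (w - a)) in Hv.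
      replace (a - w)%C with (- (w - a))%C in Hv by ring.
      rewrite Cmod_opp in Hv; lra.
    + destruct (Hf w Hwr) as [lw Hlw].
      pose proof (is_derive_comp (K := C_AbsRing) (V := AbsRing_NormedModule C_AbsRing)
                 (fun w : C => (/ w)%C) (fun w : C => (w - a)%C) w _ _
                 (is_derive_Cinv _ Hwa) (is_derive_Cid_minus a w)) as H1.
      pose proof (is_derive_minus (K := C_AbsRing) (V := X) f (fun _ => f a) w _ _ Hlw
                 (is_derive_const (K := C_AbsRing) (V := X) (f a) w)) as H2.
      exact (ex_intro _ _ (is_derive_scal_fun (V := X) (fun w : C => (/ (w - a))%C)
               (fun w => minus (f w) (f a)) w _ _ H1 H2)).
  - intros e He.
    destruct (proj1 (is_derive_eps f a l) Hl (e / 2)) as (d & Hd & H); [lra |].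
    exists d; split; [exact Hd |]; intros w Hw; rewrite Hqa.
    destruct (Ceq_dec w a) as [-> | Hwa].
    + rewrite Hqa.
      replace (minus l l) with (zero : X) by (symmetry; apply (minus_eq_zero (G := X))).
      refine (Rle_lt_trans _ 0 _ _ He); right; exact (norm_zero (V := X)).
    + assert (Hwa' : (w - a)%C <> 0).
      { intros H0; apply Hwa; replace w with (w - a + a)%C by ring; rewrite H0; ring. }
      pose proof (proj1 (Cmod_gt_0 _) Hwa') as Hpos.
      rewrite (Hq w Hwa).
      change (norm (minus ((/ (w - a))%C ** minus (f w) (f a)) l) < e).
      replace (minus ((/ (w - a))%C ** minus (f w) (f a)) l) with
        ((/ (w - a))%C ** minus (minus (f w) (f a)) ((w - a)%C ** l))
        by (module_coefs X; field; exact Hwa').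
      apply (Rle_lt_trans _ _ _ (norm_scalC _ _)).
      rewrite Cmod_inv by exact Hwa'.
      apply Rle_lt_trans with (/ Cmod (w - a) * (e / 2 * Cmod (w - a))).
      * apply Rmult_le_compat_l; [now apply Rlt_le, Rinv_0_lt_compat | now apply H].
      * replace (/ Cmod (w - a) * (e / 2 * Cmod (w - a))) with (e / 2) by (field; lra); lra.
  - intros w Hw.
    assert (Hwa' : (w - a)%C <> 0) by (apply Cmod_gt_0; lra).
    rewrite Hq.
    2:{ intros ->; apply Hwa'; ring. }
    apply (Rle_trans _ _ _ (norm_scalC _ _)).
    rewrite Cmod_inv, Hw by exact Hwa'.
    unfold Rdiv; rewrite (Rmult_comm M).
    apply Rmult_le_compat_l; [now apply Rlt_le, Rinv_0_lt_compat | now apply HM].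
Qed.

Lemma mean_value_ineq (f : C -> X) (a b : C) (L : R) :
  (forall t, 0 <= t <= 1 -> exists l,
     is_derive (K := C_AbsRing) f (a + RtoC t * (b - a))%C l /\ norm l <= L) ->
  norm (minus (f b) (f a)) <= L * Cmod (b - a).
Proof.
  intros H; apply le_epsilon; intros e He.
  set (c := Cmod (b - a)); assert (Hc : 0 <= c) by apply Cmod_ge_0.
  set (e1 := e / (c + 1)).
  assert (He1 : 0 < e1) by (apply Rdiv_lt_0_compat; lra).
  assert (He1c : e1 * c <= e).
  { replace e with (e1 * (c + 1)) at 1 by (unfold e1; field; lra).
    replace (e1 * c) with (e1 * (c + 1) - e1) by ring.
    replace (e1 * (c + 1)) with e by (unfold e1; field; lra); lra. }
  set (g := fun t : R => (a + RtoC t * (b - a))%C).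
  assert (Hg : forall s t, (g s - g t)%C = (RtoC (s - t) * (b - a))%C).
  { intros s t; unfold g; rewrite RtoC_minus; ring. }
  (* The second side of the rectangles is reduced to a point. *)
  assert (HP : norm (minus (f (g (0 + 1))) (f (g 0))) <= (L + e1) * c * 1).
  { apply (rectangle_bisection
      (fun x h _ _ => norm (minus (f (g (x + h))) (f (g x))) <= (L + e1) * c * h) 0 1 0 0);
      try lra.
    - intros x h _ _ _ _ _ _ _ _ P1 P2 _ _.
      replace (x + h / 2 + h / 2) with (x + h) in P2 by field.
      replace (minus (f (g (x + h))) (f (g x))) with
        (plus (minus (f (g (x + h))) (f (g (x + h / 2))))
              (minus (f (g (x + h / 2))) (f (g x)))) by module X.
      refine (Rle_trans _ _ _ (norm_triangle (V := X) _ _) _).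
      replace ((L + e1) * c * h) with ((L + e1) * c * (h / 2) + (L + e1) * c * (h / 2))
        by field.
      now apply Rplus_le_compat.
    - intros u v Hu _; destruct (H u) as (l & Hl & HL); [lra |].
      destruct (proj1 (is_derive_eps f _ l) Hl e1 He1) as (d & Hd & Hfd).
      fold (g u) in Hfd.
      exists (d / (c + 1)); split; [apply Rdiv_lt_0_compat; lra |].
      intros x h _ _ Hh _ Hxu _ Hx Hxh _ _.
      assert (Hhc : h * c < d).
      { apply Rle_lt_trans with (h * (c + 1)); [apply Rmult_le_compat_l; lra |].
        replace d with (d / (c + 1) * (c + 1)) by (field; lra).
        apply Rmult_lt_compat_r; lra. }
      assert (Hs : forall s, Rabs (s - u) <= h ->
        norm (minus (f (g s)) (f (g u))) <= (L + e1) * c * Rabs (s - u)).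
      { intros s Hsu.
        assert (Hm : Cmod (g s - g u) = Rabs (s - u) * c).
        { rewrite Hg, Cmod_mult, Cmod_R; reflexivity. }
        assert (Hlt : Cmod (g s - g u) < d).
        { rewrite Hm; apply Rle_lt_trans with (2 := Hhc).
          now apply Rmult_le_compat_r. }
        specialize (Hfd _ Hlt).
        replace (minus (f (g s)) (f (g u))) with
          (plus (minus (minus (f (g s)) (f (g u))) ((g s - g u)%C ** l))
                ((g s - g u)%C ** l)) by module X.
        refine (Rle_trans _ _ _ (norm_triangle (V := X) _ _) _).
        replace ((L + e1) * c * Rabs (s - u))
          with (e1 * (Rabs (s - u) * c) + Rabs (s - u) * c * L) by ring.
        apply Rplus_le_compat; [rewrite <- Hm; exact Hfd |].
        apply (Rle_trans _ _ _ (norm_scalC _ _)); rewrite Hm.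
        apply Rmult_le_compat_l; [| exact HL].
        apply Rmult_le_pos; [apply Rabs_pos | exact Hc]. }
      replace (minus (f (g (x + h))) (f (g x))) with
        (minus (minus (f (g (x + h))) (f (g u))) (minus (f (g x)) (f (g u))))
        by module X.
      refine (Rle_trans _ _ _ (norm_minus_le (V := X) _ _) _).
      assert (E1 : Rabs (x + h - u) = x + h - u) by (apply Rabs_pos_eq; lra).
      assert (E2 : Rabs (x - u) = u - x) by (rewrite Rabs_left1; lra).
      replace ((L + e1) * c * h) with
        ((L + e1) * c * Rabs (x + h - u) + (L + e1) * c * Rabs (x - u))
        by (rewrite E1, E2; ring).
      apply Rplus_le_compat; apply Hs; lra. }
  unfold g in HP; rewrite Rplus_0_l in HP.
  replace (a + RtoC 1 * (b - a))%C with b in HP by ring.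
  replace (a + RtoC 0 * (b - a))%C with a in HP by ring.
  apply (Rle_trans _ _ _ HP); lra.
Qed.

Lemma disk_convex (z a b : C) r t : 0 <= t <= 1 ->
  disk z r a -> disk z r b -> disk z r (a + RtoC t * (b - a))%C.
Proof.
  unfold disk; intros Ht Ha Hb.
  replace (a + RtoC t * (b - a) - z)%C with
    (RtoC (1 - t) * (a - z) + RtoC t * (b - z))%C by (rewrite RtoC_minus; ring).
  apply (Rle_lt_trans _ _ _ (Cmod_triangle _ _)).
  rewrite !Cmod_mult, !Cmod_R, !Rabs_pos_eq by lra.
  destruct (Req_dec t 0) as [-> | Ht0].
  - lra.
  - assert ((1 - t) * Cmod (a - z) <= (1 - t) * r) by (apply Rmult_le_compat_l; lra).
    assert (t * Cmod (b - z) < t * r) by (apply Rmult_lt_compat_l; lra).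
    lra.
Qed.

Lemma disk_plus (z a v : C) r s t : disk z r a -> Cmod v <= s -> r + s <= t ->
  disk z t (a + v)%C.
Proof.
  unfold disk; intros Ha Hv Ht.
  replace (a + v - z)%C with ((a - z) + v)%C by ring.
  apply (Rle_lt_trans _ _ _ (Cmod_triangle _ _)); lra.
Qed.

(** The point is that the bounds depend on [f] only through [B]. *)
Lemma quadratic_remainder (f : C -> X) (z : C) (r B : R) : 0 < r ->
  (forall w, disk z (4 * r) w -> ex_derive (K := C_AbsRing) f w) ->
  (forall w, disk z (4 * r) w -> norm (f w) <= B) ->
  forall a, disk z (2 * r) a -> exists l, norm l <= 2 * B / r /\
    forall b, disk z (2 * r) b ->
      norm (minus (minus (f b) (f a)) ((b - a)%C ** l)) <= 2 * (2 * B / r) / r * Cmod (b - a) ^ 2.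
Proof.
  intros Hr Hf HB a Ha.
  assert (Hin : forall w v s, disk z s w -> Cmod (v - w) <= r -> s <= 3 * r -> disk z (4 * r) v).
  { intros w v s Hw Hv Hs; replace v with (w + (v - w))%C by ring.
    apply (disk_plus z w _ s r); [assumption | assumption | lra]. }
  assert (HL : forall w l, disk z (3 * r) w -> is_derive (K := C_AbsRing) f w l ->
    norm l <= 2 * B / r).
  { intros w l Hw Hl; apply (norm_derive_le f w l r (2 * B) Hr); [| | exact Hl].
    - intros v Hv; apply Hf, (Hin w v _ Hw Hv); lra.
    - intros v Hv; refine (Rle_trans _ _ _ (norm_minus_le (V := X) _ _) _).
      assert (norm (f v) <= B) by (apply HB, (Hin w v _ Hw); lra).
      assert (norm (f w) <= B).
      { apply HB, (Hin w w _ Hw); [| lra].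
        replace (w - w)%C with (RtoC 0) by ring; rewrite Cmod_0; lra. }
      lra. }
  assert (Hlip : forall v w, disk z (3 * r) v -> disk z (3 * r) w ->
    norm (minus (f w) (f v)) <= 2 * B / r * Cmod (w - v)).
  { intros v w Hv Hw; apply mean_value_ineq; intros t Ht.
    pose proof (disk_convex z v w _ t Ht Hv Hw) as Hd.
    destruct (Hf (v + RtoC t * (w - v))%C) as [l Hl].
    { unfold disk in *; lra. }
    exists l; split; [exact Hl | exact (HL _ l Hd Hl)]. }
  (* The derivative at [w] minus that at [a] is the derivative of a difference of
     translates of [f], which is small since [f] is Lipschitz. *)
  assert (HD : forall w l l', disk z (2 * r) w -> is_derive (K := C_AbsRing) f a l ->
    is_derive (K := C_AbsRing) f w l' ->
    norm (minus l' l) <= 2 * (2 * B / r * Cmod (w - a)) / r).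
  { intros w l l' Hw Hl Hl'.
    set (h := fun v : C => minus (f (v - (a - w))%C) (f v)).
    assert (Htr : forall v m, is_derive (K := C_AbsRing) f (v - (a - w))%C m ->
      is_derive (K := C_AbsRing) (fun v : C => f (v - (a - w))%C) v m).
    { intros v m Hm; rewrite <- (scal_one m).
      exact (is_derive_comp (K := C_AbsRing) (V := X) f (fun v : C => (v - (a - w))%C) v _ _
               Hm (is_derive_Cid_minus (a - w)%C v)). }
    assert (H3 : forall u v, disk z (2 * r) u -> Cmod (v - a) <= r -> disk z (3 * r) (u + (v - a))%C).
    { intros u v Hu Hv; apply (disk_plus z u _ (2 * r) r); [assumption | assumption | lra]. }
    assert (H3a : forall v, Cmod (v - a) <= r -> disk z (3 * r) v).
    { intros v Hv; replace v with (a + (v - a))%C by ring; now apply H3. }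
    assert (H3w : forall v, Cmod (v - a) <= r -> disk z (3 * r) (v - (a - w))%C).
    { intros v Hv; replace (v - (a - w))%C with (w + (v - a))%C by ring; now apply H3. }
    assert (Hh : forall v, Cmod (v - a) <= r -> norm (h v) <= 2 * B / r * Cmod (w - a)).
    { intros v Hv; unfold h.
      replace (w - a)%C with (v - (a - w) - v)%C by ring.
      apply Hlip; [now apply H3a | now apply H3w]. }
    apply (norm_derive_le h a _ r); [exact Hr | | |].
    - intros v Hv.
      destruct (Hf v) as [m Hm]; [pose proof (H3a v Hv); unfold disk in *; lra |].
      destruct (Hf (v - (a - w))%C) as [m' Hm']; [pose proof (H3w v Hv); unfold disk in *; lra |].
      exists (minus m' m).
      exact (is_derive_minus (K := C_AbsRing) (V := X) _ _ _ _ _ (Htr v m' Hm') Hm).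
    - intros v Hv; refine (Rle_trans _ _ _ (norm_minus_le (V := X) _ _) _).
      assert (norm (h v) <= 2 * B / r * Cmod (w - a)) by (apply Hh; lra).
      assert (norm (h a) <= 2 * B / r * Cmod (w - a)).
      { apply Hh; replace (a - a)%C with (RtoC 0) by ring; rewrite Cmod_0; lra. }
      lra.
    - refine (is_derive_minus (K := C_AbsRing) (V := X) _ _ _ _ _ (Htr a l' _) Hl).
      replace (a - (a - w))%C with w by ring; exact Hl'. }
  destruct (Hf a) as [l Hl]; [unfold disk in *; lra |].
  exists l; split; [apply (HL a l); [unfold disk in *; lra | exact Hl] |].
  intros b Hb.
  assert (HB0 : 0 <= B).
  { apply (Rle_trans _ _ _ (norm_ge_0 (f a))), HB; unfold disk in *; lra. }
  set (g := fun w : C => minus (f w) ((w - a)%C ** l)).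
  replace (minus (minus (f b) (f a)) ((b - a)%C ** l)) with (minus (g b) (g a))
    by (unfold g; module X).
  replace (2 * (2 * B / r) / r * Cmod (b - a) ^ 2)
    with (2 * (2 * B / r * Cmod (b - a)) / r * Cmod (b - a)) by (field; lra).
  apply mean_value_ineq; intros t Ht.
  pose proof (disk_convex z a b _ t Ht Ha Hb) as Hw.
  set (w := (a + RtoC t * (b - a))%C) in *.
  destruct (Hf w) as [l' Hl']; [unfold disk in *; lra |].
  exists (minus l' l); split.
  - rewrite <- (scal_one l) at 1.
    exact (is_derive_minus (K := C_AbsRing) (V := X) _ _ _ _ _ Hl'
             (is_derive_scal_l (K := C_AbsRing) (V := X) (fun w : C => (w - a)%C) w _ l
                (is_derive_Cid_minus a w))).
  - apply (Rle_trans _ _ _ (HD w l l' Hw Hl Hl')).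
    assert (Hwa : Cmod (w - a) <= Cmod (b - a)).
    { replace (w - a)%C with (RtoC t * (b - a))%C by (unfold w; ring).
      rewrite Cmod_mult, Cmod_R, Rabs_pos_eq by lra.
      rewrite <- (Rmult_1_l (Cmod (b - a))) at 2.
      apply Rmult_le_compat_r; [apply Cmod_ge_0 | lra]. }
    apply Rmult_le_compat_r; [now apply Rlt_le, Rinv_0_lt_compat |].
    apply Rmult_le_compat_l; [lra |].
    apply Rmult_le_compat_l; [| exact Hwa].
    apply Rmult_le_pos; [lra | now apply Rlt_le, Rinv_0_lt_compat].
Qed.


End CauchyEstimates.

(** * Bounds from growth near the unit circle *)

Lemma bounded_on_square {V : NormedModule C_AbsRing} (g : C -> V) (x0 y0 a0 : R) : 0 <= a0 ->
  (forall u v, x0 <= u <= x0 + a0 -> y0 <= v <= y0 + a0 ->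
     ex_derive (K := C_AbsRing) g (u, v)) ->
  exists G, forall u v, x0 <= u <= x0 + a0 -> y0 <= v <= y0 + a0 -> norm (g (u, v)) <= G.
Proof.
  intros Ha Hg.
  apply (rectangle_bisection (fun x a y b =>
    exists G, forall u v, x <= u <= x + a -> y <= v <= y + b -> norm (g (u, v)) <= G));
    [exact Ha | exact Ha | |].
  - intros x a y b _ _ _ _ _ _ [G1 H1] [G2 H2] [G3 H3] [G4 H4].
    exists (Rmax (Rmax G1 G2) (Rmax G3 G4)); intros u v Hu Hv.
    pose proof (Rmax_l (Rmax G1 G2) (Rmax G3 G4)); pose proof (Rmax_r (Rmax G1 G2) (Rmax G3 G4)).
    pose proof (Rmax_l G1 G2); pose proof (Rmax_r G1 G2).
    pose proof (Rmax_l G3 G4); pose proof (Rmax_r G3 G4).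
    destruct (Rle_dec u (x + a / 2)), (Rle_dec v (y + b / 2)).
    + specialize (H1 u v); lra.
    + specialize (H3 u v); lra.
    + specialize (H2 u v); lra.
    + specialize (H4 u v); lra.
  - intros u v Hu Hv.
    destruct (ex_derive_cont g (u, v) (Hg u v Hu Hv) 1 Rlt_0_1) as (d & Hd & H).
    exists (d / 2); split; [lra |].
    intros x a y b Ha' Hb' Hxu Hyv _ _ _ _; exists (norm (g (u, v)) + 1); intros u' v' Hu' Hv'.
    assert (H1 : Cmod ((u', v') - (u, v))%C < d).
    { apply (Rle_lt_trans _ _ _ (Cmod_le_abs (u' + - u) (v' + - v))).
      assert (Rabs (u' + - u) < d / 2) by (apply Rabs_lt_between; lra).
      assert (Rabs (v' + - v) < d / 2) by (apply Rabs_lt_between; lra).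
      lra. }
    specialize (H _ H1).
    replace (g (u', v')) with (plus (g (u, v)) (minus (g (u', v')) (g (u, v)))) by module V.
    refine (Rle_trans _ _ _ (norm_triangle (V := V) _ _) _); lra.
Qed.

Lemma bounded_on_disk {V : NormedModule C_AbsRing} (g : C -> V) (z : C) r : 0 < r ->
  (forall w, disk z (3 * r) w -> ex_derive (K := C_AbsRing) g w) ->
  exists G, forall w, disk z r w -> norm (g w) <= G.
Proof.
  destruct z as [p q]; intros Hr Hg.
  destruct (bounded_on_square g (p - r) (q - r) (2 * r)) as [G HG]; [lra | |].
  - intros u v Hu Hv; apply Hg; unfold disk.
    apply (Rle_lt_trans _ _ _ (Cmod_le_abs (u + - p) (v + - q))).
    assert (Rabs (u + - p) <= r) by (apply Rabs_le; lra).
    assert (Rabs (v + - q) <= r) by (apply Rabs_le; lra).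
    lra.
  - exists G; intros [u v] Hw; unfold disk in Hw.
    pose proof (Rle_lt_trans _ _ _ (Rmax_Cmod _) Hw) as H; simpl in H.
    assert (Hu : Rabs (u + - p) < r) by (apply Rle_lt_trans with (2 := H), Rmax_l).
    assert (Hv : Rabs (v + - q) < r) by (apply Rle_lt_trans with (2 := H), Rmax_r).
    apply Rabs_lt_between in Hu, Hv; apply HG; lra.
Qed.

Section Weight.

Context {X : CompleteNormedModule C_AbsRing}.

(** The quadratic polynomial in [v] that equals [v * (Cmod (a + v) ^ 2 - 1)] on the
    circle [Cmod v = r]: it vanishes where that circle, moved to the centre [a], meets
    the unit circle. *)
Definition circle_weight (a : C) (r : R) (v : C) : C :=
  ((Cconj a * v + RtoC (Cmod a ^ 2 + r ^ 2 - 1)) * v + a * RtoC (r ^ 2))%C.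

Lemma Cmod_sqr (z : C) : Cmod z ^ 2 = fst z ^ 2 + snd z ^ 2.
Proof.
  unfold Cmod; apply pow2_sqrt.
  pose proof (pow2_ge_0 (fst z)); pose proof (pow2_ge_0 (snd z)); lra.
Qed.

Lemma circle_weightE a r v : Cmod v = r ->
  circle_weight a r v = (v * RtoC (Cmod (a + v) ^ 2 - 1))%C.
Proof.
  intros <-; unfold circle_weight; rewrite !Cmod_sqr.
  destruct a, v; apply injective_projections; simpl; ring.
Qed.

Lemma ex_derive_circle_weight a r (w : C) :
  ex_derive (K := C_AbsRing) (V := AbsRing_NormedModule C_AbsRing)
    (fun w : C => circle_weight a r (w - a)) w.
Proof.
  set (m := RtoC (Cmod a ^ 2 + r ^ 2 - 1)).
  exists (Cconj a * (RtoC 2 * (w - a)) + m)%C.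
  apply is_derive_eps; intros e He.
  pose proof (Cmod_ge_0 (Cconj a)) as Ha.
  exists (e / (1 + Cmod (Cconj a))); split; [apply Rdiv_lt_0_compat; lra |].
  intros v Hv.
  change (Cmod (circle_weight a r (v - a) - circle_weight a r (w - a)
            - (v - w) * (Cconj a * (RtoC 2 * (w - a)) + m)) <= e * Cmod (v - w)).
  replace (circle_weight a r (v - a) - circle_weight a r (w - a)
            - (v - w) * (Cconj a * (RtoC 2 * (w - a)) + m))%C
    with (Cconj a * (v - w) * (v - w))%C by (unfold circle_weight; fold m; ring).
  rewrite !Cmod_mult; apply Rmult_le_compat_r; [apply Cmod_ge_0 |].
  apply Rlt_le in Hv.
  apply (Rmult_le_compat_l _ _ _ Ha) in Hv; apply (Rle_trans _ _ _ Hv).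
  apply Rle_trans with ((1 + Cmod (Cconj a)) * (e / (1 + Cmod (Cconj a)))).
  - apply Rmult_le_compat_r; [apply Rlt_le, Rdiv_lt_0_compat |]; lra.
  - right; field; lra.
Qed.

Lemma norm_scalC_ge (c : C) (v : X) : Cmod c * norm v <= norm (c ** v).
Proof.
  destruct (Ceq_dec c 0) as [-> | Hc].
  - rewrite Cmod_0, Rmult_0_l; apply norm_ge_0.
  - pose proof (proj1 (Cmod_gt_0 _) Hc) as Hpos.
    assert (E : v = (/ c)%C ** (c ** v)) by (module_coefs X; field; exact Hc).
    pose proof (norm_scalC (/ c)%C (c ** v)) as H; rewrite <- E, Cmod_inv in H by exact Hc.
    apply (Rmult_le_compat_l (Cmod c)) in H; [| lra].
    rewrite <- Rmult_assoc, Rinv_r, Rmult_1_l in H; [exact H | lra].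
Qed.

(** The bound stays finite when the circle crosses the unit circle, where the hypothesis
    says nothing on [f]. *)
Lemma norm_le_of_circle_blowup (f : C -> X) (a : C) (r K : R) : 0 < r -> 0 <= K ->
  (forall w : C, Cmod (w - a) <= r -> ex_derive (K := C_AbsRing) f w) ->
  (forall w : C, Cmod (w - a) = r -> norm (f w) * Rabs (Cmod w - 1) <= K) ->
  norm (f a) * (Cmod a * r) <= K * (Cmod a + r + 1).
Proof.
  intros Hr HK Hf Hb.
  set (p := fun w : C => circle_weight a r (w - a) ** f w).
  assert (Hp : forall w, Cmod (w - a) <= r -> ex_derive (K := C_AbsRing) p w).
  { intros w Hw; destruct (Hf w Hw) as [l Hl], (ex_derive_circle_weight a r w) as [c Hc].
    eexists; exact (is_derive_scal_fun _ _ _ _ _ Hc Hl). }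
  assert (H : norm (p a) <= r * (K * (Cmod a + r + 1))).
  { apply (norm_center_le p a r _ Hr).
    - intros w Hw; apply Hp; lra.
    - apply (ex_derive_cont (V := X) p a), Hp.
      replace (a - a)%C with (RtoC 0) by ring; rewrite Cmod_0; lra.
    - intros w Hw; unfold p; apply (Rle_trans _ _ _ (norm_scalC _ _)).
      rewrite circle_weightE by exact Hw.
      replace (a + (w - a))%C with w by ring.
      rewrite Cmod_mult, Cmod_R, Hw, Rmult_assoc.
      apply Rmult_le_compat_l; [lra |].
      replace (Cmod w ^ 2 - 1) with ((Cmod w - 1) * (Cmod w + 1)) by ring.
      pose proof (Cmod_ge_0 w) as Hw0.
      rewrite Rabs_mult, (Rabs_pos_eq (Cmod w + 1)) by lra.
      assert (Hwle : Cmod w <= Cmod a + r).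
      { rewrite <- Hw; replace w with (a + (w - a))%C at 1 by ring; apply Cmod_triangle. }
      replace (Rabs (Cmod w - 1) * (Cmod w + 1) * norm (f w))
        with (norm (f w) * Rabs (Cmod w - 1) * (Cmod w + 1)) by ring.
      apply Rmult_le_compat; [| lra | now apply Hb | lra].
      apply Rmult_le_pos; [apply norm_ge_0 | apply Rabs_pos]. }
  assert (Hpa : Cmod a * r ^ 2 * norm (f a) <= norm (p a)).
  { unfold p, circle_weight.
    replace ((Cconj a * (a - a) + RtoC (Cmod a ^ 2 + r ^ 2 - 1)) * (a - a) + a * RtoC (r ^ 2))%C
      with (a * RtoC (r ^ 2))%C by ring.
    refine (Rle_trans _ _ _ _ (norm_scalC_ge _ _)).
    rewrite Cmod_mult, Cmod_R, (Rabs_pos_eq (r ^ 2)) by (apply pow2_ge_0); lra. }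
  apply Rmult_le_reg_l with r; [exact Hr |].
  apply Rle_trans with (2 := Rle_trans _ _ _ Hpa H); right; ring.
Qed.

End Weight.

(** * Extension of the resolvent *)

Lemma open_disk (a : C) r : open (disk a r).
Proof.
  intros z Hz; unfold disk in Hz.
  assert (He : 0 < (r - Cmod (z - a)) / 2) by lra.
  exists (mkposreal _ He); intros w [H1 H2].
  change (Rabs (fst w - fst z) < (r - Cmod (z - a)) / 2) in H1.
  change (Rabs (snd w - snd z) < (r - Cmod (z - a)) / 2) in H2.
  unfold disk; replace (w - a)%C with ((w - z) + (z - a))%C by ring.
  apply (Rle_lt_trans _ _ _ (Cmod_triangle _ _)).
  pose proof (Cmod_le_abs (fst w - fst z) (snd w - snd z)) as H3.
  change (Cmod (w - z) <= Rabs (fst w - fst z) + Rabs (snd w - snd z)) in H3.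
  lra.
Qed.

Section Resolvent.

Context {X : CompleteNormedModule C_AbsRing}.
Variables (x : linf X) (z0 : C) (r : R) (g : C -> X).
Hypothesis (Hz0 : Cmod z0 = 1) (Hr : 0 < r).
Hypothesis Hg : holomorphic_on (disk z0 r) g.
Hypothesis Hgx : forall z, disk z0 r z -> 1 < Cmod z -> g z = Ztransform x z.

(** The [k]-th term of the only sequence that starts with [g l / l] and solves
    [l y_k - y_(k+1) = x k]. *)
Fixpoint cand (k : nat) (l : C) : X :=
  match k with
  | O => (/ l)%C ** g l
  | S k => minus (l ** cand k l) (x k)
  end.

(** A radius on which the estimates below hold: points closer than this to
    [z0] are in the domain of [g] and away from [0]. *)
Definition safe_radius : R := Rmin (r / 4) (1 / 4).

Lemma safe_radius_pos : 0 < safe_radius.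
Proof. apply Rmin_pos; lra. Qed.

Lemma safe_radius_le_r : safe_radius <= r / 4.
Proof. apply Rmin_l. Qed.

Lemma safe_radius_le_quarter : safe_radius <= 1 / 4.
Proof. apply Rmin_r. Qed.

Lemma Cmod_near l : disk z0 safe_radius l -> 3 / 4 < Cmod l < 5 / 4.
Proof.
  intros Hl; pose proof safe_radius_le_quarter; unfold disk in Hl.
  pose proof (Cmod_triangle z0 (l - z0)) as H1.
  replace (z0 + (l - z0))%C with l in H1 by ring.
  pose proof (Cmod_triangle l (- (l - z0))) as H2.
  replace (l + - (l - z0))%C with z0 in H2 by ring.
  rewrite Cmod_opp in H2; lra.
Qed.

Lemma cand_holomorphic k l : disk z0 safe_radius l -> ex_derive (K := C_AbsRing) (cand k) l.
Proof.
  intros Hl; pose proof (Cmod_near l Hl) as Hm.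
  assert (Hl0 : l <> 0) by (apply Cmod_gt_0; lra).
  induction k as [| k [m Hk]].
  - destruct (Hg l) as [m Hm']; [pose proof safe_radius_le_r; unfold disk in *; lra |].
    exact (ex_intro _ _ (is_derive_scal_fun (V := X) (fun l : C => (/ l)%C) g l _ _
                           (is_derive_Cinv l Hl0) Hm')).
  - pose proof (is_derive_scal_fun (V := X) (fun l : C => l) (cand k) l _ _
                  (is_derive_id (K := C_AbsRing) l) Hk) as H1.
    exact (ex_intro _ _ (is_derive_minus (K := C_AbsRing) (V := X) _ (fun _ => x k) l _ _ H1
                           (is_derive_const (K := C_AbsRing) (V := X) (x k) l))).
Qed.

Lemma cand_outside k l : disk z0 safe_radius l -> 1 < Cmod l ->
  cand k l = (/ l)%C ** Ztransform (Nat.iter k shift x) l.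
Proof.
  intros Hl H1; assert (Hl0 : l <> 0) by (apply Cmod_gt_0; lra).
  induction k as [| k IH]; simpl.
  - f_equal; apply Hgx; [pose proof safe_radius_le_r; unfold disk in *; lra | exact H1].
  - rewrite IH, <- Ztransform_shift by exact H1.
    rewrite iter_shift; simpl.
    module_coefs X; field; exact Hl0.
Qed.

(** [down_seq l x k] is bounded in [k] when [Cmod l < 1]; see [norm_down_seq]. *)
Lemma cand_inside k l : cand k l = plus ((l ^ k)%C ** cand O l) (down_seq l x k).
Proof.
  induction k as [| k IH].
  - simpl; module X.
  - change (cand (S k) l) with (minus (l ** cand k l) (x k)).
    change (down_seq l x (S k)) with (minus (l ** down_seq l x k) (x k)).
    rewrite IH, Cpow_S; module X.
Qed.

Lemma cand_blowup : exists K, 0 <= K /\ forall k l, disk z0 safe_radius l ->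
  norm (cand k l) * Rabs (Cmod l - 1) <= K.
Proof.
  destruct (linf_bounded x) as [M HM].
  assert (HM0 : 0 <= M) by exact (Rle_trans _ _ _ (norm_ge_0 _) (HM O)).
  pose proof safe_radius_pos as Hpos; pose proof safe_radius_le_r as Hle.
  destruct (bounded_on_disk g z0 safe_radius Hpos) as [G HG].
  { intros w Hw; apply Hg; unfold disk in *; lra. }
  assert (HG0 : 0 <= G).
  { apply (Rle_trans _ _ _ (norm_ge_0 (g z0))), HG; unfold disk.
    replace (z0 - z0)%C with (RtoC 0) by ring; rewrite Cmod_0; exact Hpos. }
  exists (2 * M + 2 * G); split; [lra |]; intros k l Hl.
  pose proof (Cmod_near l Hl) as Hm.
  assert (Hl0 : l <> 0) by (apply Cmod_gt_0; lra).
  destruct (Rtotal_order (Cmod l) 1) as [Hlt | [Heq | Hgt]].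
  - rewrite cand_inside, Rabs_left by lra.
    assert (H0 : norm (cand O l) <= 2 * G).
    { simpl; apply (Rle_trans _ _ _ (norm_scalC _ _)).
      rewrite Cmod_inv by exact Hl0.
      apply Rmult_le_compat; [apply Rlt_le, Rinv_0_lt_compat; lra | apply norm_ge_0 | |].
      - replace 2 with (/ / 2) by field; apply Rinv_le_contravar; lra.
      - now apply HG. }
    assert (H1 : norm ((l ^ k)%C ** cand O l) <= 2 * G).
    { apply (Rle_trans _ _ _ (norm_scalC _ _)); rewrite Cmod_pow.
      assert (H : Cmod l ^ k <= 1).
      { rewrite <- (pow1 k); apply pow_incr; lra. }
      pose proof (norm_ge_0 (cand O l)) as H2.
      pose proof (Rmult_le_compat_r _ _ _ H2 H); lra. }
    pose proof (norm_down_seq l x M k Hlt HM) as H2.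
    apply Rle_trans with ((2 * G + M / (1 - Cmod l)) * - (Cmod l - 1)).
    + apply Rmult_le_compat_r; [lra |].
      refine (Rle_trans _ _ _ (norm_triangle (V := X) _ _) _).
      now apply Rplus_le_compat.
    + replace ((2 * G + M / (1 - Cmod l)) * - (Cmod l - 1))
        with (2 * G * (1 - Cmod l) + M) by (field; lra).
      assert (2 * G * (1 - Cmod l) <= 2 * G * 1) by (apply Rmult_le_compat_l; lra); lra.
  - rewrite Heq, Rminus_eq_0, Rabs_R0, Rmult_0_r; lra.
  - rewrite cand_outside, Rabs_pos_eq by (assumption || lra).
    assert (H1 : norm (Ztransform (Nat.iter k shift x) l) <= M / (1 - / Cmod l)).
    { apply norm_Ztransform_le; [exact Hgt |]; intros n; rewrite iter_shift; apply HM. }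
    apply Rle_trans with (/ Cmod l * (M / (1 - / Cmod l)) * (Cmod l - 1)).
    + apply Rmult_le_compat_r; [lra |].
      apply (Rle_trans _ _ _ (norm_scalC _ _)).
      rewrite Cmod_inv by exact Hl0.
      apply Rmult_le_compat_l; [apply Rlt_le, Rinv_0_lt_compat; lra | exact H1].
    + replace (/ Cmod l * (M / (1 - / Cmod l)) * (Cmod l - 1)) with M by (field; lra); lra.
Qed.

Lemma cand_bounded : exists B, forall k l, disk z0 (safe_radius / 2) l -> norm (cand k l) <= B.
Proof.
  destruct cand_blowup as (K & HK & H); pose proof safe_radius_pos as Hpos.
  exists (24 * K / safe_radius); intros k l Hl.
  assert (Hin : forall w : C, Cmod (w - l) <= safe_radius / 4 -> disk z0 safe_radius w).
  { intros w Hw; replace w with (l + (w - l))%C by ring.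
    apply (disk_plus z0 l _ (safe_radius / 2) (safe_radius / 4)); [exact Hl | exact Hw | lra]. }
  pose proof (norm_le_of_circle_blowup (cand k) l (safe_radius / 4) K) as Hb.
  assert (Hm : 3 / 4 < Cmod l < 5 / 4) by (apply Cmod_near; unfold disk in *; lra).
  pose proof safe_radius_le_quarter.
  specialize (Hb ltac:(lra) HK (fun w Hw => cand_holomorphic k w (Hin w Hw))).
  specialize (Hb (fun w Hw => H k w (Hin w (Req_le _ _ Hw)))).
  pose proof (norm_ge_0 (cand k l)) as Hn.
  apply Rmult_le_reg_r with (safe_radius / 8); [lra |].
  replace (24 * K / safe_radius * (safe_radius / 8)) with (K * 3) by (field; lra).
  apply Rle_trans with (norm (cand k l) * (Cmod l * (safe_radius / 4))).
  - apply Rmult_le_compat_l; [exact Hn |].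
    replace (safe_radius / 8) with (1 / 2 * (safe_radius / 4)) by field.
    apply Rmult_le_compat_r; lra.
  - apply (Rle_trans _ _ _ Hb), Rmult_le_compat_l; lra.
Qed.

(** The sequence of the [cand k l] as a bounded sequence; unspecified when it is
    unbounded. *)
Definition cand_linf (l : C) : linf X :=
  epsilon (inhabits zero) (fun y : linf X => forall k, y k = cand k l).

Lemma cand_linfE k l : disk z0 (safe_radius / 2) l -> cand_linf l k = cand k l.
Proof.
  intros Hl; revert k; unfold cand_linf; apply epsilon_spec.
  destruct cand_bounded as [B HB].
  assert (Hy : exists B, forall k, norm (cand k l) <= B) by (exists B; intros k; now apply HB).
  now exists (Linf (fun k => cand k l) Hy).
Qed.

Lemma cls_cand_linf_resolvent l : disk z0 (safe_radius / 2) l -> Cmod l <> 1 ->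
  cls (cand_linf l) = resolvent l Sbar (cls (W := c0 X) x).
Proof.
  intros Hl Hl1.
  destruct (Sbar_bijective l (cls x) Hl1) as (u & _ & Hu).
  transitivity u; [symmetry |]; apply Hu; [| now apply Sbar_resolventE].
  rewrite Sbar_cls, <- cls_scal.
  refine (eq_trans (eq_sym (cls_minus (c0 X) _ _)) _).
  f_equal; apply linf_eq; intros k.
  change (minus (l ** cand_linf l k) (cand_linf l (S k)) = x k).
  rewrite !cand_linfE by exact Hl; exact (minus_minus_r _ (x k)).
Qed.

(** The derivatives of the coordinates form a bounded sequence, and its class is the
    derivative. *)
Lemma cls_cand_linf_holomorphic :
  holomorphic_on (disk z0 (safe_radius / 4)) (fun l => cls (W := c0 X) (cand_linf l)).
Proof.
  intros a Ha; pose proof safe_radius_pos as Hpos.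
  destruct cand_bounded as [B HB].
  set (s := safe_radius / 8); set (K := 2 * (2 * B / s) / s).
  assert (Hs : 0 < s) by (unfold s; lra).
  assert (Hdisk : forall w, disk z0 (2 * s) w -> disk z0 (safe_radius / 2) w)
    by (unfold disk, s; intros; lra).
  assert (HD : forall k, exists l, norm l <= 2 * B / s /\
    forall b, disk z0 (2 * s) b ->
      norm (minus (minus (cand k b) (cand k a)) ((b - a)%C ** l)) <= K * Cmod (b - a) ^ 2).
  { intros k; apply (quadratic_remainder (cand k) z0 s B Hs).
    - intros w Hw; apply cand_holomorphic; unfold disk, s in *; lra.
    - intros w Hw; apply HB; unfold disk, s in *; lra.
    - unfold disk, s in *; lra. }
  destruct (choice _ HD) as [D HDk]; clear HD.
  assert (HDb : exists M, forall k, norm (D k) <= M).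
  { exists (2 * B / s); intros k; apply HDk. }
  set (Dl := Linf D HDb).
  exists (cls Dl); apply is_derive_eps; intros e He.
  assert (Ha' : disk z0 (2 * s) a) by (unfold disk, s in *; lra).
  assert (HK : 0 <= K).
  { assert (HB0 : 0 <= B).
    { apply (Rle_trans _ _ _ (norm_ge_0 (cand O a))), HB, Hdisk, Ha'. }
    unfold K; repeat apply Rmult_le_pos; try lra; now apply Rlt_le, Rinv_0_lt_compat. }
  exists (Rmin (2 * s - Cmod (a - z0)) (e / (K + 1))); split.
  { apply Rmin_pos; [unfold disk in Ha'; lra | apply Rdiv_lt_0_compat; lra]. }
  intros w Hw.
  pose proof (Rlt_le_trans _ _ _ Hw (Rmin_l _ _)) as Hw1.
  pose proof (Rlt_le_trans _ _ _ Hw (Rmin_r _ _)) as Hw2; clear Hw.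
  assert (Hw' : disk z0 (2 * s) w).
  { unfold disk; replace (w - z0)%C with ((w - a) + (a - z0))%C by ring.
    apply (Rle_lt_trans _ _ _ (Cmod_triangle _ _)); lra. }
  assert (Hlin : norm (minus (minus (cand_linf w) (cand_linf a)) ((w - a)%C ** Dl))
                 <= K * Cmod (w - a) ^ 2).
  { apply linf_norm_le; intros k.
    change (norm (minus (minus (cand_linf w k) (cand_linf a k)) ((w - a)%C ** D k))
            <= K * Cmod (w - a) ^ 2).
    rewrite !cand_linfE by now apply Hdisk.
    now apply HDk. }
  assert (E : minus (minus (cls (W := c0 X) (cand_linf w)) (cls (cand_linf a)))
                ((w - a)%C ** cls Dl)
              = cls (minus (minus (cand_linf w) (cand_linf a)) ((w - a)%C ** Dl))).
  { rewrite <- cls_scal.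
    refine (eq_trans (f_equal (fun u => minus u _) (eq_sym (cls_minus (c0 X) _ _))) _).
    exact (eq_sym (cls_minus (c0 X) _ _)). }
  refine (Rle_trans _ _ _ (Req_le _ _ (f_equal norm E)) _).
  apply (Rle_trans _ _ _ (quot_norm_le (c0 X) _)), (Rle_trans _ _ _ Hlin).
  replace (K * Cmod (w - a) ^ 2) with (K * Cmod (w - a) * Cmod (w - a)) by ring.
  apply Rmult_le_compat_r; [apply Cmod_ge_0 |].
  pose proof (Cmod_ge_0 (w - a)) as H0.
  apply Rle_trans with ((K + 1) * (e / (K + 1))); [apply Rmult_le_compat; lra |].
  right; field; lra.
Qed.

End Resolvent.

Theorem lemma3p3 (X : CompleteNormedModule C_AbsRing) (x : linf X) (z0 : C)
    (hz0 : Cmod z0 = 1%R) (hext : has_holomorphic_extension (Ztransform x) z0) :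
  ~ spectrum x z0.
Proof.
  intros [_ H]; apply H; clear H.
  destruct hext as (r & g & Hr & Hg & Hgx).
  set (s := safe_radius r / 4).
  assert (Hs : 0 < s).
  { unfold s; pose proof (safe_radius_pos r Hr); lra. }
  exists (disk z0 s), (fun l => cls (cand_linf x g l)).
  split; [| split; [| split]].
  - apply open_disk.
  - unfold disk; replace (z0 - z0)%C with (RtoC 0) by ring; rewrite Cmod_0; exact Hs.
  - now apply cls_cand_linf_holomorphic.
  - intros l Hl; apply (cls_cand_linf_resolvent x z0 r g); try assumption.
    unfold disk, s in *; lra.
Qed.
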